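(* Let $L \in \mathbb{R}^{n\times n}$ be symmetric positive semidefinite, let $K := L^{+}$, let $V \in \mathbb{R}^{n\times k}$ have orthonormal columns whose span contains the null space of $L$, let $t>0$, and define $P(t) := e^{-Lt}$ and $\tilde P(t) := V e^{-(V^\top L V)t} V^\top$. Put $$\nu_2 := \|K - V(V^\top L V)^{+}V^\top\|_2,\qquad \nu_* := \|K - V(V^\top L V)^{+}V^\top\|_* .$$ Then $$\|P(t)-\tilde P(t)\|_2 \le \frac{3\sqrt3}{2\pi}\,\frac{\nu_2}{t}\qquad\text{and}\qquad \|P(t)-\tilde P(t)\|_* \le \frac{3\sqrt3}{2\pi}\,\frac{\nu_*}{t}.$$
   Context: $\|\cdot\|_2$ is the spectral norm (largest singular value) and $\|\cdot\|_*$ the nuclear norm (sum of singular values). $A^+$ denotes the Moore-Penrose pseudoinverse. *)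

(* Defs.v *)
From HB Require Import structures.
From mathcomp Require Import all_boot all_order all_algebra.
From mathcomp Require Import spectral complex.
From mathcomp Require Import all_classical all_reals all_analysis.
Set Implicit Arguments.
Unset Strict Implicit.
Unset Printing Implicit Defensive.
Import Order.TTheory GRing.Theory Num.Theory.
Import numFieldNormedType.Exports.
Local Open Scope classical_set_scope.
Local Open Scope ring_scope.

Section definitions.
Context {R : realType}.

Definition psdmx n (L : 'M[R]_n) : Prop :=
  L^T = L /\ forall x : 'cV[R]_n, 0 <= (x^T *m L *m x) 0 0.

(* The limit is taken for the entrywise topology on matrices; the series always
   converges, see is_cvg_mxexp. *)
Definition mxexp n (A : 'M[R]_n) : 'M[R]_n :=
  limn (series (fun j => (j`!%:R)^-1 *: A ^+ j)).

(* The four Penrose equations; they have exactly one solution, see mpinvP and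
   mpinv_unique. *)
Definition is_mpinv m n (A : 'M[R]_(m, n)) (X : 'M[R]_(n, m)) : Prop :=
  [/\ A *m X *m A = A, X *m A *m X = X,
      (A *m X)^T = A *m X & (X *m A)^T = X *m A].

Definition mpinv m n (A : 'M[R]_(m, n)) : 'M[R]_(n, m) :=
  xget 0 [set X | is_mpinv A X].

(* s lists, in decreasing order, the square roots of the eigenvalues of A^T A,
   with multiplicity. There are always n of them, so for m < n the usual
   min(m, n) singular values are padded with zeros, which affects neither the
   largest one nor the sum. Such an s exists and is unique, see
   singular_valuesP and is_singular_values_uniq. *)
Definition is_singular_values m n (A : 'M[R]_(m, n)) (s : seq R) : Prop :=
  [/\ all (>= 0) s, sorted >=%R s &
      char_poly (A^T *m A) = \prod_(x <- s) ('X - (x ^+ 2)%:P)].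

Definition singular_values m n (A : 'M[R]_(m, n)) : seq R :=
  xget [::] [set s | is_singular_values A s].

Definition spectral_norm m n (A : 'M[R]_(m, n)) : R :=
  \big[Num.max/0]_(x <- singular_values A) x.

Definition nuclear_norm m n (A : 'M[R]_(m, n)) : R :=
  \sum_(x <- singular_values A) x.

End definitions.

Section facts.
Context {R : realType}.

Lemma sqnorm_ge0 n (v : 'rV[R]_n) : 0 <= (v *m v^T) 0 0.
Proof.
by rewrite mxE sumr_ge0// => i _; rewrite mxE -expr2 sqr_ge0.
Qed.

Lemma sqnorm_eq0 n (v : 'rV[R]_n) : ((v *m v^T) 0 0 == 0) = (v == 0).
Proof.
apply/idP/eqP => [|->]; last by rewrite mul0mx mxE.
rewrite mxE psumr_eq0 => [/allP v0|i _]; last by rewrite mxE -expr2 sqr_ge0.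
apply/rowP => i; have := v0 i (mem_index_enum i).
by rewrite !mxE -expr2 sqrf_eq0 => /eqP.
Qed.

Lemma gram_unit m n (C : 'M[R]_(m, n)) : row_free C -> C *m C^T \in unitmx.
Proof.
move=> Cfree; rewrite -row_free_unit -kermx_eq0.
apply/rowV0P => v /sub_kermxP vCC; apply/eqP.
rewrite -(mulmx_free_eq0 _ Cfree) -sqnorm_eq0 trmx_mul mulmxA -(mulmxA v).
by rewrite vCC mul0mx mxE.
Qed.

Lemma full_rank_mpinv m n r (B : 'M[R]_(m, r)) (C : 'M[R]_(r, n)) :
  row_full B -> row_free C ->
  is_mpinv (B *m C) (C^T *m invmx (C *m C^T) *m invmx (B^T *m B) *m B^T).
Proof.
move=> Bfull Cfree; have UC := gram_unit Cfree.
have UB : B^T *m B \in unitmx.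
  by rewrite -{2}[B]trmxK gram_unit// /row_free mxrank_tr.
set IC := invmx (C *m C^T); set IB := invmx (B^T *m B).
have AX : B *m C *m (C^T *m IC *m IB *m B^T) = B *m IB *m B^T.
  by rewrite !mulmxA -(mulmxA B) -(mulmxA B _ IC) mulmxV// mulmx1.
have XA : C^T *m IC *m IB *m B^T *m (B *m C) = C^T *m IC *m C.
  by rewrite !mulmxA -(mulmxA _ B^T) -(mulmxA _ IB) mulVmx// mulmx1.
have symC : IC^T = IC by rewrite trmx_inv trmx_mul trmxK.
have symB : IB^T = IB by rewrite trmx_inv trmx_mul trmxK.
split.
- by rewrite AX !mulmxA -(mulmxA _ B^T) -(mulmxA _ IB) mulVmx// mulmx1.
- rewrite XA !mulmxA -(mulmxA _ C) -(mulmxA (C^T *m IC)) mulmxV//.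
  by rewrite mulmx1.
- by rewrite AX !trmx_mul trmxK symB mulmxA.
- by rewrite XA !trmx_mul trmxK symC mulmxA.
Qed.

Lemma mpinv_exists m n (A : 'M[R]_(m, n)) : exists X, is_mpinv A X.
Proof.
have := full_rank_mpinv (col_base_full A) (row_base_free A).
by rewrite mulmx_base; eexists; eassumption.
Qed.

Lemma is_mpinv_uniq m n (A : 'M[R]_(m, n)) X Y :
  is_mpinv A X -> is_mpinv A Y -> X = Y.
Proof.
move=> [AXA XAX AXT XAT] [AYA YAY AYT YAT].
have AXY : A *m X = A *m Y.
  rewrite -AXT -{1}AYA -(mulmxA (A *m Y)) trmx_mul AXT AYT.
  by rewrite mulmxA AXA.
have XAY : X *m A = Y *m A.
  have -> : X *m A = (X *m A) *m (Y *m A) by rewrite -mulmxA (mulmxA A) AYA.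
  by rewrite -XAT -YAT -trmx_mul -mulmxA (mulmxA A) AXA YAT.
by rewrite -XAX XAY -mulmxA AXY mulmxA.
Qed.

Lemma mpinvP m n (A : 'M[R]_(m, n)) : is_mpinv A (mpinv A).
Proof. by have [X AX] := mpinv_exists A; exact: (xgetI 0 AX). Qed.

Lemma mpinv_unique m n (A : 'M[R]_(m, n)) X : is_mpinv A X -> X = mpinv A.
Proof. by move=> AX; exact: is_mpinv_uniq AX (mpinvP A). Qed.

Lemma mx_norm_mul_le n (A B : 'M[R]_n) : `|A *m B| <= n%:R * `|A| * `|B|.
Proof.
rewrite {1}/Num.norm/= mx_normrE; apply/bigmax_leP; split=> [|[i j] _ /=].
  by rewrite !mulr_ge0.
rewrite mxE (le_trans (ler_norm_sum _ _ _))//.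
rewrite (@le_trans _ _ (\sum_(l < n) `|A| * `|B|))//.
  apply: ler_sum => l _; rewrite normrM ler_pM//.
    by rewrite [leRHS]/Num.norm/= mx_normrE; apply/bigmax_geP; right; exists (i, l).
  by rewrite [leRHS]/Num.norm/= mx_normrE; apply/bigmax_geP; right; exists (l, j).
by rewrite sumr_const card_ord -[X in X <= _]mulr_natl mulrA.
Qed.

Lemma mx_norm_exp_le n (A : 'M[R]_n) j : `|A ^+ j| <= (n%:R * `|A|) ^+ j.
Proof.
elim: j => [|j IHj].
  rewrite !expr0 /Num.norm/= mx_normrE; apply/bigmax_leP; split=> [//|[i l] _ /=].
  by rewrite mxE normr_nat lern1 leq_b1.
by rewrite !exprS (le_trans (mx_norm_mul_le _ _))// ler_wpM2l// mulr_ge0.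
Qed.

Lemma is_cvg_mxexp n (A : 'M[R]_n) :
  cvgn (series (fun j => (j`!%:R)^-1 *: A ^+ j)).
Proof.
set u := fun j => _.
suff /cauchy_cvgP/cauchy_seriesP ucvg : cvgn [normed series u].
  apply/cauchy_cvgP/cauchy_seriesP => e /ucvg; apply: filterS => N /=.
  rewrite ger0_norm ?sumr_ge0//; apply: le_lt_trans; exact: ler_norm_sum.
apply: series_le_cvg (is_cvg_series_exp_coeff (n%:R * `|A|)).
- by move=> j /=.
- by move=> j; rewrite exp_coeff_ge0// mulr_ge0.
- move=> j /=; rewrite normrZ ger0_norm ?invr_ge0// mulrC.
  by rewrite ler_wpM2r ?invr_ge0// mx_norm_exp_le.
Qed.

Lemma gram_char_poly m n (A : 'M[R]_(m, n)) : exists d : 'I_n -> R,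
  char_poly (A^T *m A) = \prod_(i < n) ('X - (d i)%:P).
Proof.
set G := A^T *m A; pose toC := real_complex R.
set Gc : 'M[R[i]]_n := map_mx toC G.
have Gh : Gc \is hermsymmx.
  apply: realsym_hermsym.
    apply/is_hermitianmxP; rewrite expr0 scale1r map_mx_id//.
    by rewrite map_trmx trmx_mul trmxK.
  by apply/mxOverP => i j; rewrite mxE; apply/complex_realP; eexists.
have /orthomx_spectralP := hermitian_normalmx Gh.
have /mxOverP dreal := hermitian_spectral_diag_real Gh.
set P := spectralmx Gc; set D := spectral_diag Gc => GE.
have Pu : P \in unitmx := spectral_unit Gc.
exists (fun i => complex.Re (D 0 i)); apply: (@map_poly_inj _ _ toC).
rewrite map_char_poly -/Gc rmorph_prod/=.
have -> : char_poly Gc = char_poly (diag_mx D).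
  rewrite /char_poly GE /char_poly_mx.
  set Q := map_mx polyC P; set Qi := map_mx polyC (invmx P).
  have QiQ : Qi *m Q = 1%:M by rewrite -map_mxM/= mulVmx// map_mx1.
  have -> : 'X%:M - map_mx polyC (invmx P *m diag_mx D *m P) =
            Qi *m ('X%:M - map_mx polyC (diag_mx D)) *m Q.
    rewrite !map_mxM/= mulmxBr mulmxBl; congr (_ - _).
    by rewrite scalar_mxC -mulmxA QiQ mulmx1.
  by rewrite !det_mulmx mulrAC -det_mulmx QiQ det1 mul1r.
rewrite char_poly_trig ?diag_mx_is_trig//; apply: eq_bigr => i _.
rewrite rmorphB/= map_polyX map_polyC/= mxE eqxx mulr1n.
by rewrite RRe_real// dreal.
Qed.

Lemma gram_eigenvalue_ge0 m n (A : 'M[R]_(m, n)) a :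
  root (char_poly (A^T *m A)) a -> 0 <= a.
Proof.
rewrite -eigenvalue_root_char => /eigenvalueP[v vG v0].
have v_gt0 : 0 < (v *m v^T) 0 0 by rewrite lt0r sqnorm_eq0 v0 sqnorm_ge0.
rewrite -(pmulr_lge0 _ v_gt0).
have := sqnorm_ge0 (v *m A^T).
by rewrite trmx_mul trmxK mulmxA -(mulmxA v) vG -scalemxAl mxE.
Qed.

Lemma is_singular_values_exists m n (A : 'M[R]_(m, n)) :
  exists s, is_singular_values A s.
Proof.
have [d dE] := gram_char_poly A.
have d_ge0 i : 0 <= d i.
  apply: (@gram_eigenvalue_ge0 _ _ A).
  rewrite dE rootE horner_prod; apply/prodf_eq0; exists i => //.
  by rewrite hornerXsubC subrr.
exists (sort >=%R [seq Num.sqrt (d i) | i : 'I_n]); split.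
- by rewrite all_sort; apply/allP => _ /mapP[i _ ->]; exact: sqrtr_ge0.
- by apply: sort_sorted => x y /=; rewrite le_total.
- rewrite dE (perm_big _ (permEl (perm_sort _ _))) big_map big_enum/=.
  by apply: eq_bigr => i _; rewrite sqr_sqrtr.
Qed.

Lemma is_singular_values_uniq m n (A : 'M[R]_(m, n)) s s' :
  is_singular_values A s -> is_singular_values A s' -> s = s'.
Proof.
move=> [s0 ss sE] [s'0 ss' s'E].
apply: (@sorted_eq _ >=%R) => //.
- by move=> y x z /= yx zy; exact: le_trans zy yx.
- by move=> x y /=; rewrite andbC => /le_anti.
have sqK t : all (>= 0) t ->
    t = [seq Num.sqrt x | x <- [seq x ^+ 2 | x <- t]] :> seq R.
  move=> /allP t0; rewrite -map_comp -[LHS]map_id; apply/eq_in_map => x xt /=.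
  by rewrite sqrtr_sqr ger0_norm// t0.
rewrite (sqK s)// (sqK s')//; apply: perm_map.
by apply: prod_XsubC_eq; rewrite !big_map -sE -s'E.
Qed.

Lemma singular_valuesP m n (A : 'M[R]_(m, n)) :
  is_singular_values A (singular_values A).
Proof.
by have [s As] := is_singular_values_exists A; exact: (xgetI [::] As).
Qed.

End facts.

(* Main.v *)
Require Import Defs.
From mathcomp Require Import all_boot all_order all_algebra.
From mathcomp Require Import spectral sesquilinear complex ring lra.
From mathcomp Require Import all_classical all_reals all_analysis.
From mathcomp Require Import measurable_realfun.
Import Order.TTheory GRing.Theory Num.Theory.
Import numFieldNormedType.Exports.
Set Implicit Arguments.
Unset Strict Implicit.
Unset Printing Implicit Defensive.
Local Open Scope ring_scope.

(* With f(x) = e^(-t/x) and f(0) = 0, the kernel condition makes the null spaces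
   cancel, so that P - Pt = f(K) - f(Kt), where Kt = V (V^T L V)^+ V^T. The
   contour integral of e^(-tz) / (z - L) over the two rays z = r e^(+-i th) gives
     f(a) - f(b) = (a - b) / pi * Im \int_0^oo e^(i th) e^(-tz) /
                                        ((za - 1) (zb - 1)) dr,
   that is, f(K) - f(Kt) is an average of (zK - 1)^-1 (K - Kt) (zKt - 1)^-1. Both
   resolvents have norm at most 1 / sin th, and both norms of the theorem are dual
   to a set of matrices that is stable under multiplication by contractions; hence
   the constant 1 / (pi cos th sin^2 th), which is least, and equal to
   3 sqrt 3 / (2 pi), when cos th = 1 / sqrt 3. *)

(** * Scalar integrals along a ray *)

Section RayIntegral.
Local Open Scope classical_set_scope.
Local Open Scope ring_scope.
Context {R : realType}.
Local Notation mu := (@lebesgue_measure R).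
Local Notation D0 := (`[0, +oo[%classic : set R).

(** The eigenvalues enter through their inverses because 1 / (z - 1 / a) = a / (z a - 1), and a / (z
    a - 1) - b / (z b - 1) = (b - a) / ((z a - 1) (z b - 1)): apart from the factor b - a, this is a
    function of a times a function of b. In eigenbases of K and Kt such a product is a
    multiplication by diagonal matrices on the left and on the right, while f(a) - f(b) itself does
    not split. The average is taken only after pairing with a dual matrix, on a finite double sum of
    real numbers, so no matrix is ever integrated. The scalar integrals are evaluated without
    residues: as functions of t they solve a linear differential equation, and their behavior at 0
    or at infinity fixes the constant. In the bound, each resolvent costs 1 / sin th because, for x
    >= 0, the points z x lie on a ray at distance sin th from 1; the factor 1 / (t cos th) is the
    integral of |e^(-tz)|. *)

Lemma continuous_FTC2_0y (f F : R -> R) (l : R) :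
  (forall x, 0 <= x -> 0 <= f x) -> continuous f ->
  (forall x : R, is_derive x 1 F (f x)) -> F x @[x --> +oo] --> l ->
  mu.-integrable D0 (EFin \o f) /\ \int[mu]_(x in D0) f x = l - F 0.
Proof.
move=> f0 cf dF Fl.
have E : (\int[mu]_(x in D0) (f x)%:E = l%:E - (F 0)%:E)%E.
  apply: ge0_continuous_FTC2y => //.
  - exact: continuous_subspaceT.
  - apply: cvg_at_right_filter; apply: differentiable_continuous.
    exact/derivable1_diffP.
  - by move=> x _; rewrite derive1E; apply: derive_val.
split; last by rewrite /Rintegral E.
apply/integrableP; split.
  by apply/measurable_EFinP/measurable_funTS; exact: continuous_measurable_fun.
rewrite [X in (X < _)%E](_ : _ = \int[mu]_(x in D0) (f x)%:E)%E.
  by rewrite E ltry.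
apply: eq_integral => x; rewrite inE/= in_itv/= andbT => /f0 fx.
by rewrite ger0_norm.
Qed.

Lemma is_derive_continuous (f : R -> R) (df : R -> R) :
  (forall x : R, is_derive x 1 f (df x)) -> continuous f.
Proof.
by move=> fdf x; apply/differentiable_continuous/derivable1_diffP; apply: ex_derive.
Qed.

Lemma cvg_expRM_bounded (k C : R) (g : R -> R) : 0 < k ->
  (forall x, `|g x| <= C) -> expR (- (k * x)) * g x @[x --> +oo] --> 0.
Proof.
move=> k0 gC; apply: norm_cvg0.
have kC : expR (- (k * x)) * C @[x --> +oo] --> 0.
  rewrite -[0](mul0r C); apply: cvgMr_tmp.
  apply: (cvg_comp (fun x => k * x) (fun x => expR (- x))); last exact: cvgr_expR.
  by apply: gt0_cvgMry => //; exact: cvg_id.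
apply: (@squeeze_cvgr _ _ _ _ (cst 0) _ _ _ _ _ kC); last exact: cvg_cst.
apply: nearW => x /=; rewrite normr_ge0 normrM ger0_norm ?expR_ge0//=.
by rewrite ler_wpM2l ?expR_ge0.
Qed.

Lemma integral_expR_decay (k : R) : 0 < k ->
  mu.-integrable D0 (EFin \o (fun x => expR (- (k * x)))) /\
  \int[mu]_(x in D0) expR (- (k * x)) = k^-1.
Proof.
move=> k0; rewrite (_ : k^-1 = 0 - expR (- (k * 0)) * (- k^-1)); last first.
  by rewrite mulr0 oppr0 expR0; ring.
apply: (@continuous_FTC2_0y _ (fun x => expR (- (k * x)) * - k^-1)).
- by move=> x _; exact: expR_ge0.
- by apply: is_derive_continuous.
- move=> x; apply: is_derive_eq; rewrite /GRing.scale/=; field.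
  by rewrite gt_eqF.
- by apply: (@cvg_expRM_bounded _ `|- k^-1|).
Qed.

(** The integrand is the derivative of [expR (- (k * x)) * sin (m * x)], which vanishes at 0 and at
    infinity. *)
Lemma integral_expR_osc (k m : R) : 0 < k ->
  let f x := expR (- (k * x)) * (m * cos (m * x) - k * sin (m * x)) in
  mu.-integrable D0 (EFin \o f) /\ \int[mu]_(x in D0) f x = 0.
Proof.
move=> k0 f; pose C := `|m| + k.
(* Adding [C] makes the integrand nonnegative, as the improper FTC requires. *)
pose g x := expR (- (k * x)) * (m * cos (m * x) - k * sin (m * x) + C).
have bnd x : `|m * cos (m * x) - k * sin (m * x)| <= C.
  rewrite (le_trans (ler_normB _ _))// !normrM (gtr0_norm k0).
  by rewrite lerD// ler_piMr ?cos_max ?sin_max// ltW.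
have [ei eE] := integral_expR_decay k0.
have [gi gE] : mu.-integrable D0 (EFin \o g) /\
    \int[mu]_(x in D0) g x = 0 - expR (- (k * 0)) * (sin (m * 0) - C / k).
  apply: (@continuous_FTC2_0y _ (fun x => expR (- (k * x)) * (sin (m * x) - C / k))).
  - move=> x _; rewrite mulr_ge0 ?expR_ge0//.
    by have := bnd x; rewrite ler_norml => /andP[]; lra.
  - by apply: is_derive_continuous.
  - move=> x; apply: is_derive_eq; rewrite /GRing.scale/= /g; field.
    by rewrite gt_eqF.
  - apply: (@cvg_expRM_bounded _ (1 + `|C / k|)) => // x.
    by rewrite (le_trans (ler_normB _ _))// lerD2r sin_max.
have Ci : mu.-integrable D0 (EFin \o (fun x => C * expR (- (k * x)))).
  exact: (integrableZl _ C ei).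
have fE : f = (fun x => g x - C * expR (- (k * x))).
  by apply/funext => x; rewrite /f /g; ring.
split.
  by rewrite fE; apply: (integrableB _ gi Ci).
rewrite fE RintegralB// RintegralZl// gE eE !mulr0 oppr0 expR0 sin0; ring.
Qed.

Variables c s : R.
Hypotheses (c0 : 0 < c) (s0 : 0 < s) (cs : c ^+ 2 + s ^+ 2 = 1).

(* The ray is z = r (c + i s). Then [ray_dist2 w r] is |z - w|^2, and
   [ray_kernel w t r] is - Im ((c + i s) e^(-tz) / (z - w)). *)
Definition ray_dist2 (w r : R) := (r - w * c) ^+ 2 + (w * s) ^+ 2.

Definition ray_kernel (w t r : R) := expR (- (t * c * r)) *
  (w * s * cos (t * s * r) + (r - w * c) * sin (t * s * r)) / ray_dist2 w r.

Lemma ray_dist2_gt0 w r : w != 0 -> 0 < ray_dist2 w r.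
Proof.
move=> w0; rewrite ltr_wpDl ?sqr_ge0// exprn_even_gt0//=.
by rewrite mulf_neq0// gt_eqF.
Qed.

Lemma is_derive_ray_dist2V (w r : R) : w != 0 ->
  is_derive r 1 (fun r => (ray_dist2 w r)^-1) (- (2 * (r - w * c)) / (ray_dist2 w r) ^+ 2).
Proof.
move=> w0; have q0 := lt0r_neq0 (ray_dist2_gt0 r w0).
have dq : is_derive r 1 (ray_dist2 w) (2 * (r - w * c)).
  apply: is_derive_eq; rewrite /GRing.scale/=; ring.
by apply: is_derive_eq (is_deriveV q0 dq) _; rewrite /GRing.scale/=; field.
Qed.

Lemma continuous_ray_kernel w t : w != 0 -> continuous (ray_kernel w t).
Proof.
move=> w0; have qV r := is_derive_ray_dist2V r w0.
by apply: is_derive_continuous.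
Qed.

(** With x = |w| s and y = |r - w c|, the trigonometric factor is at most x + y and the denominator
    is x^2 + y^2, while (x + y) x <= 2 (x^2 + y^2). The constant is crude, which is harmless: the
    bound serves only domination and decay in t. *)
Lemma norm_ray_kernel_le w t r : w != 0 ->
  `|ray_kernel w t r| <= 2 / (`|w| * s) * expR (- (t * c * r)).
Proof.
move=> w0; have q0 := ray_dist2_gt0 r w0.
have w0' : 0 < `|w| by rewrite normr_gt0.
rewrite /ray_kernel -mulrA normrM ger0_norm ?expR_ge0// mulrC ler_wpM2r ?expR_ge0//.
rewrite normrM normfV (gtr0_norm q0) ler_pdivrMr// [leRHS]mulrAC ler_pdivlMr ?mulr_gt0//.
have -> : ray_dist2 w r = `|r - w * c| ^+ 2 + (`|w| * s) ^+ 2.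
  by rewrite /ray_dist2 real_normK ?num_real// !exprMn real_normK ?num_real.
apply: (@le_trans _ _ ((`|w| * s + `|r - w * c|) * (`|w| * s))).
  rewrite ler_wpM2r ?mulr_ge0 ?(ltW s0)// (le_trans (ler_normD _ _))//.
  rewrite !normrM (gtr0_norm s0) lerD//.
    by rewrite ler_piMr ?cos_max// mulr_ge0// ltW.
  by rewrite ler_piMr ?sin_max.
have := normr_ge0 (r - w * c); have : 0 < `|w| * s by rewrite mulr_gt0.
move: (`|w| * s) `|r - w * c| => x y; nra.
Qed.

Lemma integrable_ray_kernel w t : w != 0 -> 0 < t ->
  mu.-integrable D0 (EFin \o ray_kernel w t).
Proof.
move=> w0 t0; have [ei _] := integral_expR_decay (mulr_gt0 t0 c0).
apply: le_integrable (integrableZl _ (2 / (`|w| * s)) ei) => //.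
  apply/measurable_EFinP/measurable_funTS; apply: continuous_measurable_fun.
  exact: continuous_ray_kernel.
move=> x _; rewrite /= lee_fin (le_trans (norm_ray_kernel_le _ _ w0))//.
exact: ler_norm.
Qed.

(* Im ((c + i s) e^(-tz)); its integral vanishes, since \int e^(-tz) dz = 1 / t along
   any ray. *)
Definition ray_exp (t r : R) :=
  expR (- (t * c * r)) * (s * cos (t * s * r) - c * sin (t * s * r)).

Lemma integral_ray_exp t : 0 < t ->
  mu.-integrable D0 (EFin \o ray_exp t) /\ \int[mu]_(r in D0) ray_exp t r = 0.
Proof.
move=> t0; have [fi fE] := integral_expR_osc (t * s) (mulr_gt0 t0 c0).
have -> : ray_exp t = fun r => t^-1 * (expR (- (t * c * r)) *
    (t * s * cos (t * s * r) - t * c * sin (t * s * r))).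
  by apply/funext => r; rewrite /ray_exp; field; rewrite gt_eqF.
split; first exact: (integrableZl _ t^-1 fi).
by rewrite RintegralZl// fE mulr0.
Qed.

(** Differentiating e^(-tz) / (z - w) brings down - z, and z / (z - w) = 1 + w / (z - w): the first
    term gives [ray_exp], the second the kernel again. *)
Lemma is_derive_ray_kernel (w t r : R) : w != 0 ->
  is_derive t 1 (fun t => ray_kernel w t r) (ray_exp t r - w * ray_kernel w t r).
Proof.
move=> w0; have q0 := lt0r_neq0 (ray_dist2_gt0 r w0).
apply: is_derive_eq; rewrite /GRing.scale/= /ray_exp /ray_kernel.
set X := expR _; set C := cos _; set S := sin _.
apply/eqP; rewrite -subr_eq0; apply/eqP.
transitivity ((1 - (c ^+ 2 + s ^+ 2)) * X *
    (s * w ^+ 2 * C + (w * r - c * w ^+ 2) * S) / ray_dist2 w r).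
  by move: q0; rewrite /ray_dist2 => q0; field.
by rewrite cs subrr !mul0r.
Qed.

Definition ray_integral w t := \int[mu]_(r in D0) ray_kernel w t r.

(** The term [ray_exp] of the differentiated kernel integrates to 0, which leaves y' = - w y. The
    derivative is taken under the integral over the interval from t / 2 to 2 t, away from 0, so that
    a multiple of e^(-tcr/2) dominates. *)
Lemma is_derive_ray_integral (w t : R) : w != 0 -> 0 < t ->
  is_derive t 1 (ray_integral w) (- w * ray_integral w t).
Proof.
move=> w0 t0.
have t2 : 0 < t / 2 by rewrite divr_gt0.
have It : (`](t / 2), (t * 2)[%classic : set R) t.
  by rewrite /= in_itv/=; apply/andP; split; lra.
have Ipos x : (`](t / 2), (t * 2)[%classic : set R) x -> t / 2 < x.
  by rewrite /= in_itv/= => /andP[].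
have Ipos0 x : (`](t / 2), (t * 2)[%classic : set R) x -> 0 < x.
  by move=> /Ipos; exact: lt_trans.
have iker x : (`](t / 2), (t * 2)[%classic : set R) x ->
  mu.-integrable D0 (EFin \o ray_kernel w x).
  by move=> /Ipos0 x0; exact: integrable_ray_kernel.
have dk x y : derivable (ray_kernel w ^~ y) x 1.
  by have [] := is_derive_ray_kernel x y w0.
(* The part s + c bounds the trigonometric factor of [ray_exp]; 2 / s is |w| times the constant of
   [norm_ray_kernel_le]. *)
pose C := s + c + 2 / s.
have C0 : 0 < C by rewrite !addr_gt0// divr_gt0.
pose G (r : R) := C * expR (- (t / 2 * c * r)).
have G0 r : 0 <= G r by rewrite mulr_ge0 ?expR_ge0// ltW.
have Gi : mu.-integrable D0 (EFin \o G).
  have [ei _] := integral_expR_decay (mulr_gt0 t2 c0).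
  exact: (integrableZl _ C ei).
have d1E x y : partial1of2 (ray_kernel w) x y = ray_exp x y - w * ray_kernel w x y.
  by rewrite partial1of2E; have [_ ->] := is_derive_ray_kernel x y w0.
have Gub x y : (`](t / 2), (t * 2)[%classic : set R) x -> D0 y ->
    `|partial1of2 (ray_kernel w) x y| <= G y.
  move=> /Ipos tx; rewrite /= in_itv/= andbT => y0.
  rewrite d1E; apply: (@le_trans _ _ (C * expR (- (x * c * y)))); last first.
    rewrite ler_wpM2l ?(ltW C0)// ler_expR lerN2 -![_ * c * y]mulrA ler_wpM2r ?(ltW tx)//.
    by rewrite mulr_ge0// ltW.
  rewrite (le_trans (ler_normB _ _))// mulrDl lerD//.
    rewrite /ray_exp normrM ger0_norm ?expR_ge0// mulrC ler_wpM2r ?expR_ge0//.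
    rewrite (le_trans (ler_normB _ _))// !normrM (gtr0_norm s0) (gtr0_norm c0).
    by rewrite lerD// ler_piMr ?cos_max ?sin_max// ltW.
  rewrite normrM; have w0' : 0 < `|w| by rewrite normr_gt0.
  rewrite -ler_pdivlMl// (le_trans (norm_ray_kernel_le _ _ w0))// mulrA ler_wpM2r ?expR_ge0//.
  by rewrite invfM; lra.
have [oi oE] := integral_ray_exp t0.
have ki := integrable_ray_kernel w0 t0.
apply: DeriveDef.
  exact: (derivable_under_integral _ It iker (fun x y _ _ => dk x y) G0 Gi Gub).
rewrite -derive1E.
rewrite (differentiation_under_integral _ It iker (fun x y _ _ => dk x y) G0 Gi Gub)//.
under eq_Rintegral do rewrite d1E.
have wki : mu.-integrable D0 (EFin \o (fun r => w * ray_kernel w t r)).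
  exact: (integrableZl _ w ki).
by rewrite RintegralB// RintegralZl// oE sub0r mulNr.
Qed.

Lemma derive0_const_pos (h : R -> R) (x y : R) :
  (forall t : R, 0 < t -> is_derive t 1 h 0) -> 0 < x -> 0 < y -> h x = h y.
Proof.
move=> dh; wlog xy : x y / x < y => [W x0 y0|x0 _].
  by have [xy|yx|->//] := ltgtP x y; [exact: W|apply/esym/W].
have pos t : t \in `]x, y[ -> 0 < t.
  by rewrite in_itv/= => /andP[xt _]; exact: lt_trans xt.
have ch : {within `[x, y], continuous h}.
  apply: derivable_within_continuous => t; rewrite in_itv/= => /andP[xt _].
  by have [] := dh t (lt_le_trans x0 xt).
have [t _] := MVT xy (fun t tI => dh t (pos t tI)) ch.
by rewrite mul0r => /eqP; rewrite subr_eq0 => /eqP.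
Qed.

(** The equation is given for t > 0 only, so the constant is read off at t = 1 rather than at 0. *)
Lemma linear_ode_pos (g : R -> R) (w t : R) :
  (forall t : R, 0 < t -> is_derive t 1 g (- w * g t)) -> 0 < t ->
  g t = g 1 * expR w * expR (- (w * t)).
Proof.
move=> dg t0; pose h t := expR (w * t) * g t.
have dh (x : R) : 0 < x -> is_derive x 1 h 0.
  move=> /dg dgx; apply: is_derive_eq; rewrite /GRing.scale/=; ring.
have := derive0_const_pos dh t0 ltr01; rewrite /h mulr1 [g 1 * _]mulrC => <-.
by rewrite mulrAC -expRD subrr expR0 mul1r.
Qed.

Lemma norm_ray_integral_le w t : w != 0 -> 0 < t ->
  `|ray_integral w t| <= 2 / (`|w| * s) * (t * c)^-1.
Proof.
move=> w0 t0; have ki := integrable_ray_kernel w0 t0.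
have [ei eE] := integral_expR_decay (mulr_gt0 t0 c0).
have Cei : mu.-integrable D0
    (EFin \o (fun r => 2 / (`|w| * s) * expR (- (t * c * r)))).
  exact: (integrableZl _ (2 / (`|w| * s)) ei).
rewrite -eE -RintegralZl// (le_trans (le_normr_Rintegral _ ki))//.
apply: le_Rintegral => //; first exact: integrable_norm.
by move=> r _; exact: norm_ray_kernel_le.
Qed.

(** By the differential equation the integral is C e^(lt), which grows unless C = 0, whereas
    [norm_ray_integral_le] makes it decay like 1 / t. *)
Lemma ray_integral_neg (l t : R) : 0 < l -> 0 < t -> ray_integral (- l) t = 0.
Proof.
move=> l0 t0; have Nl0 : - l != 0 by rewrite oppr_eq0 gt_eqF.
have EE x : 0 < x -> _ := linear_ode_pos (fun t => @is_derive_ray_integral _ t Nl0).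
rewrite EE//; set C := ray_integral _ _ * _.
have [->|C0] := eqVneq C 0; first by rewrite mul0r.
have C0' : 0 < `|C| by rewrite normr_gt0.
pose B := 2 / (`|- l| * s) * c^-1.
have B0 : 0 < B by rewrite mulr_gt0 ?invr_gt0// divr_gt0// mulr_gt0// normr_gt0.
(* At this x > 1 the decay bound is below B, while |C| e^(lx) >= |C| (1 + l x) = |C| (1 + l) + B. *)
pose x := 1 + B / `|C| / l.
have x1 : 1 < x by rewrite ltrDl divr_gt0 // divr_gt0.
have x0 : 0 < x := lt_trans ltr01 x1.
have := norm_ray_integral_le Nl0 x0; rewrite EE// -/C normrM (ger0_norm (expR_ge0 _)).
rewrite leNgt => /negP[]; rewrite mulNr opprK.
apply: (@le_lt_trans _ _ B).
  rewrite /B ler_wpM2l//; first by rewrite divr_ge0// mulr_ge0// ltW.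
  by rewrite lef_pV2 ?posrE ?mulr_gt0// ler_pMl// ltW.
rewrite -ltr_pdivrMl// (lt_le_trans _ (expR_ge1Dx _))//.
rewrite /x mulrDr mulr1 [l * _]mulrC divfK ?gt_eqF// mulrC; lra.
Qed.

(** In r, this is pi times the sum of two Cauchy densities of width l s, centered at l c and - l c.
    It is also the value at t = 0 of the difference of the kernels for l and - l. *)
Definition ray_poisson (l r : R) := l * s / ray_dist2 l r + l * s / ray_dist2 (- l) r.

(** The reflection r -> - r exchanges the two summands, so the half-line integral of the sum is the
    integral of one summand over the whole line. *)
Lemma integral_ray_poisson (l : R) : 0 < l ->
  mu.-integrable D0 (EFin \o ray_poisson l) /\ \int[mu]_(r in D0) ray_poisson l r = pi.
Proof.
move=> l0; have l0' := lt0r_neq0 l0; have Nl0 : - l != 0 by rewrite oppr_eq0.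
have ls0 : 0 < l * s by rewrite mulr_gt0.
pose F (r : R) := atan ((l * s)^-1 * (r - l * c)) + atan ((l * s)^-1 * (r + l * c)).
have -> : pi = (pi / 2 + pi / 2) - F 0.
  by rewrite /F sub0r add0r mulrN atanN addNr subr0; field.
apply: continuous_FTC2_0y.
- by move=> r _; rewrite addr_ge0// divr_ge0 ?(ltW ls0)// ltW// ray_dist2_gt0.
- have qV r := is_derive_ray_dist2V r l0'; have qNV r := is_derive_ray_dist2V r Nl0.
  by apply: is_derive_continuous.
- move=> r; apply: is_derive_eq.
  have q1 := lt0r_neq0 (ray_dist2_gt0 r l0'); have q2 := lt0r_neq0 (ray_dist2_gt0 r Nl0).
  rewrite /GRing.scale/=.
  have E (x : R) : 1 + ((l * s)^-1 * x) ^+ 2 = (x ^+ 2 + (l * s) ^+ 2) / (l * s) ^+ 2.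
    by field; rewrite !gt_eqF.
  rewrite !E !invfM !invrK.
  have -> : (r + l * c) ^+ 2 + (l * s) ^+ 2 = ray_dist2 (- l) r by rewrite /ray_dist2; ring.
  have -> : (r - l * c) ^+ 2 + (l * s) ^+ 2 = ray_dist2 l r by [].
  by rewrite /ray_poisson; field; rewrite q1 q2 !gt_eqF.
- have at_ (k : R) : atan ((l * s)^-1 * (r + k)) @[r --> +oo] --> pi / 2.
    apply: (cvg_comp (fun r : R => (l * s)^-1 * (r + k)) (@atan R)); last exact: cvgy_atan.
    apply: gt0_cvgMry; first by rewrite invr_gt0.
    exact: cvg_addrr.
  by apply: cvgD; exact: at_.
Qed.

(* The pole - l lies outside of the contour and contributes nothing, but subtracting
   it gives a bound that is integrable uniformly in t, down to t = 0. The absolute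
   value extends the kernel to a neighborhood of t = 0. *)
Definition ray_kernel_sub (l t r : R) := ray_kernel l `|t| r - ray_kernel (- l) `|t| r.

Lemma norm_ray_kernel_sub_le (l t r : R) : 0 < l -> 0 <= r ->
  `|ray_kernel_sub l t r| <= (s + c) / s * ray_poisson l r.
Proof.
move=> l0 r0; have l0' := lt0r_neq0 l0; have Nl0 : - l != 0 by rewrite oppr_eq0.
have q1 := ray_dist2_gt0 r l0'; have q2 := ray_dist2_gt0 r Nl0.
rewrite /ray_kernel_sub /ray_kernel; set X := expR _; set C := cos _; set S := sin _.
have X1 : X <= 1.
  by rewrite -expR0 ler_expR oppr_le0 !mulr_ge0// ltW.
have sc : (s + c) / s * ray_poisson l r =
    l * s * ((ray_dist2 l r)^-1 + (ray_dist2 (- l) r)^-1) +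
    l * c * ((ray_dist2 l r)^-1 + (ray_dist2 (- l) r)^-1).
  by rewrite /ray_poisson; field; rewrite !gt_eqF.
(* This is the coefficient of the sine. Each of its terms decays only like 1 / r, but their
   difference decays like 1 / r^2, which makes the bound integrable without help from the
   exponential. *)
set Y := (r - l * c) / ray_dist2 l r - (r + l * c) / ray_dist2 (- l) r.
have Yle : `|Y| <= l * c * ((ray_dist2 l r)^-1 + (ray_dist2 (- l) r)^-1).
  have -> : Y = 2 * (l * c) * (r ^+ 2 - l ^+ 2 * (c ^+ 2 + s ^+ 2)) /
      (ray_dist2 l r * ray_dist2 (- l) r).
    rewrite /Y; move: (lt0r_neq0 q1) (lt0r_neq0 q2); rewrite /ray_dist2 => n1 n2.
    by field; rewrite n1 n2.
  have -> : (ray_dist2 l r)^-1 + (ray_dist2 (- l) r)^-1 =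
      2 * (r ^+ 2 + l ^+ 2 * (c ^+ 2 + s ^+ 2)) / (ray_dist2 l r * ray_dist2 (- l) r).
    move: (lt0r_neq0 q1) (lt0r_neq0 q2); rewrite /ray_dist2 => n1 n2.
    by field; rewrite n1 n2.
  have qq : 0 < ray_dist2 l r * ray_dist2 (- l) r by rewrite mulr_gt0.
  rewrite normrM normfV (gtr0_norm qq) [leRHS]mulrA ler_wpM2r ?invr_ge0 ?(ltW qq)//.
  rewrite normrM ger0_norm ?mulr_ge0 ?(ltW l0) ?(ltW c0)//.
  rewrite [leRHS]mulrA [l * c * 2]mulrC ler_wpM2l ?mulr_ge0 ?(ltW l0) ?(ltW c0)//.
  rewrite cs mulr1 (le_trans (ler_normB _ _))// !ger0_norm ?sqr_ge0//.
have -> : X * (l * s * C + (r - l * c) * S) / ray_dist2 l r -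
    X * (- l * s * C + (r - - l * c) * S) / ray_dist2 (- l) r =
    X * (l * s * ((ray_dist2 l r)^-1 + (ray_dist2 (- l) r)^-1) * C + Y * S).
  by rewrite /Y; field; rewrite !gt_eqF.
rewrite normrM ger0_norm ?expR_ge0// sc.
have P0 : 0 <= l * s * ((ray_dist2 l r)^-1 + (ray_dist2 (- l) r)^-1).
  by rewrite mulr_ge0 ?addr_ge0 ?invr_ge0 ?mulr_ge0// ltW.
rewrite (le_trans (ler_piMl _ X1))// (le_trans (ler_normD _ _))//.
rewrite [`|_ * C|]normrM [`|Y * S|]normrM (ger0_norm P0) lerD//.
  by rewrite ler_piMr ?cos_max.
by rewrite (le_trans _ Yle)// ler_piMr ?sin_max.
Qed.

(* Both sides solve y' = - l y, and agree in the limit t -> 0. *)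
Lemma ray_integralE (l t : R) : 0 < l -> 0 < t -> ray_integral l t = pi * expR (- (l * t)).
Proof.
move=> l0 t0; have l0' := lt0r_neq0 l0; have Nl0 : - l != 0 by rewrite oppr_eq0.
pose N t := \int[mu]_(r in D0) ray_kernel_sub l t r.
have NE x : 0 < x -> N x = ray_integral l x.
  move=> x0; rewrite /N /ray_kernel_sub (gtr0_norm x0) RintegralB//; last 2 first.
  - exact: integrable_ray_kernel.
  - exact: integrable_ray_kernel.
  by rewrite -/(ray_integral _ _) -/(ray_integral _ _) (ray_integral_neg l0 x0) subr0.
have [pi_i piE] := integral_ray_poisson l0.
have N0 : N 0 = pi.
  rewrite -piE; apply: eq_Rintegral => r _.
  rewrite /ray_kernel_sub normr0 /ray_kernel !mul0r oppr0 expR0 cos0 sin0 /ray_poisson.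
  by rewrite !mul1r !mulr0 !addr0 !mulr1 !mulNr opprK.
have Gi : mu.-integrable D0 (EFin \o (fun r => (s + c) / s * ray_poisson l r)).
  exact: (integrableZl _ ((s + c) / s) pi_i).
have ki x : mu.-integrable D0 (EFin \o ray_kernel_sub l x).
  apply: le_integrable Gi => //.
    apply/measurable_EFinP/measurable_funTS; apply: continuous_measurable_fun.
    by move=> r; apply: cvgB; exact: continuous_ray_kernel.
  move=> r; rewrite /= in_itv/= andbT => r0; rewrite lee_fin.
  by rewrite (le_trans (norm_ray_kernel_sub_le _ l0 r0))// ler_norm.
have cN : {for 0, continuous N}.
  have I0 : (0 : R) \in (`](-1), 1[%classic : set R) by rewrite inE/= in_itv/= ltrN10 ltr01.
  apply: (continuity_under_integral (u := -1) (v := 1) _ _ _ Gi) I0 => //.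
    apply: aeW => r _ x _.
    have ck w : w != 0 -> continuous (fun t : R => ray_kernel w `|t| r).
      move=> w0 y; have dk t := is_derive_ray_kernel t r w0.
      apply: (cvg_comp (fun t : R => `|t|) (fun t => ray_kernel w t r)).
        exact: (@norm_continuous R R).
      exact: (is_derive_continuous dk).
    by apply: cvgB; exact: ck.
  move=> x _; apply: aeW => r; rewrite /= in_itv/= andbT; exact: norm_ray_kernel_sub_le.
have EE x : 0 < x -> _ := linear_ode_pos (fun t => @is_derive_ray_integral l t l0').
rewrite EE//; set C := ray_integral _ _ * _; congr (_ * _).
have NC : N x @[x --> 0^'+] --> C.
  apply: cvg_trans (_ : C * expR (- (l * x)) @[x --> 0^'+] --> C).
    apply: near_eq_cvg; near=> x.
    have x0 : 0 < x by near: x; exact: nbhs_right_gt.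
    by rewrite NE// EE.
  have cexp : continuous (fun x : R => C * expR (- (l * x))).
    by apply: is_derive_continuous.
  apply: cvg_at_right_filter; have := cexp 0.
  by rewrite /continuous_at mulr0 oppr0 expR0 mulr1.
have := cvg_at_right_filter cN; rewrite N0 => Npi.
exact: (cvg_unique _ NC Npi).
Unshelve. all: by end_near. Qed.

End RayIntegral.

(** * From the scalar integral to bounds on double sums *)

Section RayMultiplier.
Local Open Scope classical_set_scope.
Local Open Scope ring_scope.
Local Open Scope complex_scope.
Context {R : realType}.
Local Notation mu := (@lebesgue_measure R).
Local Notation D0 := (`[0, +oo[%classic : set R).
Variables c s : R.
Hypotheses (c0 : 0 < c) (s0 : 0 < s) (cs : c ^+ 2 + s ^+ 2 = 1).

(* [ray_kernel a^-1 t r], multiplied out so as to be meaningful at a = 0. *)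
Definition inv_kernel (t a r : R) := expR (- (t * c * r)) *
  (a * (s * cos (t * s * r) + (r * a - c) * sin (t * s * r))) /
  ((r * a - c) ^+ 2 + s ^+ 2).

(** The case split matters: as t / 0 = 0, the exponential alone would give 1 at a = 0 instead of the
    limit 0 from the right. *)
Definition exp_inv (t a : R) := if a == 0 then 0 else expR (- (t / a)).

Lemma integral_inv_kernel t a : 0 < t -> 0 <= a ->
  mu.-integrable D0 (EFin \o inv_kernel t a) /\
  \int[mu]_(r in D0) inv_kernel t a r = pi * exp_inv t a.
Proof.
move=> t0; rewrite le_eqVlt => /predU1P[<-|a0].
  rewrite /exp_inv eqxx mulr0.
  have -> : inv_kernel t 0 = fun=> 0.
    by apply/funext => r; rewrite /inv_kernel mul0r mulr0 mul0r.
  split; first exact: integrable0.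
  by rewrite Rintegral_cst// mul0r.
have -> : inv_kernel t a = ray_kernel c s a^-1 t.
  apply/funext => r; rewrite /inv_kernel /ray_kernel.
  have : 0 < (r * a - c) ^+ 2 + s ^+ 2 by rewrite ltr_wpDl ?sqr_ge0// exprn_gt0.
  by move=> /lt0r_neq0 n; rewrite /ray_dist2; field; rewrite (lt0r_neq0 a0).
rewrite /exp_inv gt_eqF// [t / a]mulrC.
split; first by apply: integrable_ray_kernel => //; rewrite invr_eq0 gt_eqF.
rewrite -/(ray_integral _ _ _ _) ray_integralE//. by rewrite ?invr_gt0.
Qed.

(** This is where a bound at each point of the ray becomes a bound on the average:
    [integral_inv_kernel] contributes the factor 1 / pi, and the exponential integrates to 1 / (t
    c). *)
Lemma sum_exp_inv_le (I : finType) (w a b : I -> R) (B t : R) : 0 < t ->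
  (forall p, 0 <= a p) -> (forall p, 0 <= b p) ->
  (forall r, 0 <= r ->
    \sum_p w p * (inv_kernel t (a p) r - inv_kernel t (b p) r) <= B * expR (- (t * c * r))) ->
  \sum_p w p * (exp_inv t (a p) - exp_inv t (b p)) <= B / (pi * t * c).
Proof.
move=> t0 a0 b0 H.
have tc0 : 0 < t * c by rewrite mulr_gt0.
pose g p r := w p * (inv_kernel t (a p) r - inv_kernel t (b p) r).
have gi p : mu.-integrable D0 (EFin \o g p).
  have [ai _] := integral_inv_kernel t0 (a0 p); have [bi _] := integral_inv_kernel t0 (b0 p).
  exact: (integrableZl _ (w p) (integrableB _ ai bi)).
have gE p : \int[mu]_(r in D0) g p r = pi * (w p * (exp_inv t (a p) - exp_inv t (b p))).
  have [ai aE] := integral_inv_kernel t0 (a0 p); have [bi bE] := integral_inv_kernel t0 (b0 p).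
  rewrite /g RintegralZl//; last exact: (integrableB _ ai bi).
  by rewrite RintegralB// aE bE -mulrBr mulrCA.
have sumE (e : seq I) : mu.-integrable D0 (EFin \o (fun r => \sum_(p <- e) g p r)) /\
    \int[mu]_(r in D0) (\sum_(p <- e) g p r) = \sum_(p <- e) \int[mu]_(r in D0) g p r.
  elim: e => [|p e [ei eE]].
    rewrite big_nil; under [X in EFin \o X]eq_fun do rewrite big_nil.
    under eq_Rintegral do rewrite big_nil.
    by rewrite Rintegral_cst// mul0r; split; first exact: integrable0.
  rewrite big_cons -eE; under [X in EFin \o X]eq_fun do rewrite big_cons.
  under eq_Rintegral do rewrite big_cons.
  by rewrite RintegralD//; split => //; exact: (integrableD _ (gi p) ei).
have [si sE] := sumE (index_enum I).
have [ei eE] := integral_expR_decay tc0.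
have Bi : mu.-integrable D0 (EFin \o (fun r => B * expR (- (t * c * r)))).
  exact: (integrableZl _ B ei).
have -> : B / (pi * t * c) = pi^-1 * (B * (t * c)^-1).
  by rewrite -mulrA invfM mulrCA.
rewrite ler_pdivlMl ?pi_gt0// mulr_sumr -eE -RintegralZl//.
under eq_bigr do rewrite -gE.
rewrite -sE; apply: le_Rintegral => // r; rewrite /= in_itv/= andbT; exact: H.
Qed.

(** At each r, the difference of kernels at a i and b j is the imaginary part of a i - b j times a
    function of a i times a function of b j. Scaled by s, both functions have modulus at most 1, so
    the hypothesis applies to them; undoing the scaling costs 1 / s^2. *)
Lemma Re_schur_exp_inv_le (I J : finType) (C : I -> J -> R[i]) (a : I -> R) (b : J -> R)
    (nu t : R) : 0 < t -> (forall i, 0 <= a i) -> (forall j, 0 <= b j) ->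
  (forall (x : I -> R[i]) (y : J -> R[i]),
    (forall i, `|x i| <= 1) -> (forall j, `|y j| <= 1) ->
    `|\sum_i \sum_j C i j * (a i - b j)%:C * x i * y j| <= nu%:C) ->
  complex.Re (\sum_i \sum_j C i j * (exp_inv t (a i) - exp_inv t (b j))%:C) <=
    nu / s ^+ 2 / (pi * t * c).
Proof.
move=> t0 a0 b0 H.
have -> : complex.Re (\sum_i \sum_j C i j * (exp_inv t (a i) - exp_inv t (b j))%:C) =
    \sum_(p : I * J) complex.Re (C p.1 p.2) * (exp_inv t (a p.1) - exp_inv t (b p.2)).
  rewrite pair_bigA/= raddf_sum; apply: eq_bigr => p _.
  by case: (C _ _) => x y; rewrite /= mulr0 subr0.
apply: sum_exp_inv_le => // r r0.
pose X := expR (- (t * c * r)); pose co := cos (t * s * r); pose si := sin (t * s * r).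
pose Q x := (r * x - c) ^+ 2 + s ^+ 2.
have Q0 x : 0 < Q x by rewrite ltr_wpDl ?sqr_ge0// exprn_gt0.
(* Up to a phase, [v x] is s / (z x - 1). *)
pose v x : R[i] := s * (r * x - c) / Q x +i* - (s ^+ 2 / Q x).
(* This is e^(-tz) / s^2 times e^(-i th), the phase left of e^(i th) once each of the two factors
   [v] has absorbed one e^(i th). *)
pose eps : R[i] := (X / s ^+ 2)%:C * ((co * c - si * s) +i* - (co * s + si * c)).
have kapE x y : inv_kernel t x r - inv_kernel t y r =
    complex.Im (eps * ((x - y)%:C * v x * v y)).
  rewrite /inv_kernel -/X -/co -/si /eps /v /=.
  by have := lt0r_neq0 (Q0 x); have := lt0r_neq0 (Q0 y); rewrite /Q => n1 n2; field;
    rewrite n1 n2 gt_eqF.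
have v1 x : `|v x| <= 1.
  rewrite normc_def lecR -[leRHS]sqrtr1 ler_wsqrtr//=.
  have -> : (s * (r * x - c) / Q x) ^+ 2 + (- (s ^+ 2 / Q x)) ^+ 2 = s ^+ 2 / Q x.
    by have := lt0r_neq0 (Q0 x); rewrite /Q => n; field.
  by rewrite ler_pdivrMr// mul1r /Q lerDr sqr_ge0.
have epsE : `|eps| = (X / s ^+ 2)%:C.
  have -> : `|eps| = `|(X / s ^+ 2)%:C| * `|(co * c - si * s) +i* - (co * s + si * c)|.
    by rewrite normrM.
  rewrite ger0_norm; last by rewrite ler0c divr_ge0 ?expR_ge0 ?sqr_ge0.
  rewrite [X in _ * X]normc_def/=.
  have -> : (co * c - si * s) ^+ 2 + (- (co * s + si * c)) ^+ 2 =
      (co ^+ 2 + si ^+ 2) * (c ^+ 2 + s ^+ 2) by ring.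
  by rewrite cs cos2Dsin2 mulr1 sqrtr1 mulr1.
pose S (u : R -> R[i]) :=
  \sum_i \sum_j C i j * (a i - b j)%:C * u (a i) * u (b j).
pose Z := \sum_i \sum_j C i j * (inv_kernel t (a i) r - inv_kernel t (b j) r)%:C.
have -> : \sum_(p : I * J)
    complex.Re (C p.1 p.2) * (inv_kernel t (a p.1) r - inv_kernel t (b p.2) r) =
    complex.Re Z.
  rewrite /Z pair_bigA/= raddf_sum; apply: eq_bigr => p _.
  by case: (C _ _) => x y; rewrite /= mulr0 subr0.
have conj4 (e u w : R[i]) (x : R) :
    (e * (x%:C * u * w))^*%C = e^*%C * (x%:C * u^*%C * w^*%C).
  have conjM (x1 x2 : R[i]) : (x1 * x2)^*%C = x1^*%C * x2^*%C by exact: rmorphM.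
  by rewrite !conjM conjc_real.
(* The weights C are complex, so the imaginary part cannot be taken outside the sum. Written as i /
   2 times (conjugate minus number), it leaves two sums whose multipliers are both of product
   form. *)
have ZE : Z = 'i%C / 2 * (eps^*%C * S (fun x => (v x)^*%C) - eps * S v).
  rewrite /Z /S !mulr_sumr -sumrB mulr_sumr; apply: eq_bigr => i _.
  rewrite !mulr_sumr -sumrB mulr_sumr; apply: eq_bigr => j _.
  rewrite kapE ImJ_sub conj4; ring.
have Zle : `|Z| <= (nu / s ^+ 2 * X)%:C.
  have n2 : `|'i%C / 2 : R[i]| = 2^-1.
    by rewrite normrM normfV normc_def/= expr0n expr1n add0r sqrtr1 mul1r normr_nat.
  have bound (u : R -> R[i]) (e : R[i]) : `|e| = (X / s ^+ 2)%:C -> (forall x, `|u x| <= 1) ->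
      `|e * S u| <= (nu / s ^+ 2 * X)%:C.
    move=> eE u1; rewrite normrM eE.
    have -> : (nu / s ^+ 2 * X)%:C = (X / s ^+ 2)%:C * nu%:C.
      by rewrite -rmorphM/=; congr (_%:C); ring.
    rewrite ler_wpM2l//; first by rewrite ler0c divr_ge0 ?expR_ge0 ?sqr_ge0.
    by apply: H => ?; exact: u1.
  rewrite ZE normrM n2 ler_pdivrMl// mulr_natl mulr2n.
  rewrite (le_trans (ler_normB _ _))// lerD//.
    by apply: bound; [rewrite normcJ|move=> x; rewrite normcJ].
  exact: bound.
rewrite -lecR (le_trans _ Zle)// (le_trans _ (normc_ge_Re _))//.
by rewrite lecR ler_norm.
Qed.

End RayMultiplier.

(** * Complex contractions acting on row vectors *)

Section Contractions.
Local Open Scope sesquilinear_scope.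
Context {C : numClosedFieldType}.

Definition normsq n (u : 'rV[C]_n) : C := (u *m u^t*) 0 0.

Lemma adjmxM m n p (A : 'M[C]_(m, n)) (B : 'M[C]_(n, p)) :
  (A *m B)^t* = B^t* *m A^t*.
Proof. by rewrite trmx_mul map_mxM. Qed.

Lemma normsqE n (u : 'rV[C]_n) : normsq u = \sum_i `|u 0 i| ^+ 2.
Proof. by rewrite /normsq mxE; apply: eq_bigr => i _; rewrite !mxE normCK. Qed.

Lemma normsq_ge0 n (u : 'rV[C]_n) : 0 <= normsq u.
Proof. by rewrite normsqE sumr_ge0// => i _; rewrite exprn_ge0. Qed.

Lemma normsq_CauchySchwarz n (u v : 'rV[C]_n) :
  `|(u *m v^t*) 0 0| ^+ 2 <= normsq u * normsq v.
Proof. by rewrite /normsq -!dotmxE; have [] := CauchySchwarz (@dotmx C n) u v. Qed.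

Lemma norm_inner_le (n : nat) (u v : 'rV[C]_n) (a b : C) : 0 <= a -> 0 <= b ->
  normsq u <= a ^+ 2 -> normsq v <= b ^+ 2 -> `|(u *m v^t*) 0 0| <= a * b.
Proof.
move=> a0 b0 ua vb; rewrite -(@ler_pXn2r _ 2)// ?nnegrE ?mulr_ge0//.
rewrite (le_trans (normsq_CauchySchwarz _ _))// exprMn.
by rewrite ler_pM ?normsq_ge0.
Qed.

Definition contractmx m n (S : 'M[C]_(m, n)) :=
  forall x : 'rV_m, normsq (x *m S) <= normsq x.

Lemma contractmxM m n p (S : 'M[C]_(m, n)) (T : 'M[C]_(n, p)) :
  contractmx S -> contractmx T -> contractmx (S *m T).
Proof. by move=> cS cT x; rewrite mulmxA (le_trans (cT _)). Qed.

(** With y = x S^*, the Cauchy-Schwarz inequality gives |y|^2 = <y S, x> <= |y S| |x| <= |y| |x|. *)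
Lemma contractmx_adj m n (S : 'M[C]_(m, n)) : contractmx S -> contractmx (S^t*).
Proof.
move=> cS x; set y := x *m S^t*.
have [->|y0] := eqVneq (normsq y) 0; first exact: normsq_ge0.
have y_gt0 : 0 < normsq y by rewrite lt_def y0 normsq_ge0.
have yE : normsq y = (y *m S *m x^t*) 0 0.
  by rewrite {1}/normsq {2}/y adjmxM trmxCK mulmxA.
rewrite -(ler_pM2l y_gt0).
have := normsq_CauchySchwarz (y *m S) x; rewrite -yE ger0_norm ?normsq_ge0//.
rewrite expr2 => /le_trans; apply.
by rewrite ler_wpM2r ?normsq_ge0.
Qed.

Lemma contractmx_coisometry m n (S : 'M[C]_(m, n)) :
  S *m S^t* = 1%:M -> contractmx S.
Proof. by move=> SS x; rewrite /normsq adjmxM mulmxA -(mulmxA x) SS mulmx1. Qed.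

Lemma contractmx_diag n (d : 'rV[C]_n) :
  (forall i, `|d 0 i| <= 1) -> contractmx (diag_mx d).
Proof.
move=> d1 x; rewrite !normsqE; apply: ler_sum => i _.
rewrite mul_mx_diag mxE normrM exprMn ler_piMr ?exprn_ge0//.
by rewrite exprn_ile1.
Qed.

End Contractions.

(** * Trace duality and bilinear forms for singular values *)

Section Dual.
Local Open Scope sesquilinear_scope.
Context {C : numClosedFieldType}.

Lemma row_inner m n (M N : 'M[C]_(m, n)) i :
  (row i M *m (row i N)^t*) 0 0 = (M *m N^t*) i i.
Proof. by rewrite !mxE; apply: eq_bigr => j _; rewrite !mxE. Qed.

Lemma diag_form n (v d : 'rV[C]_n) :
  (v *m diag_mx d *m v^t*) 0 0 = \sum_i `|v 0 i| ^+ 2 * d 0 i.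
Proof.
rewrite mxE; apply: eq_bigr => i _.
by rewrite mul_mx_diag !mxE mulrAC -normCK.
Qed.

Variables (m n : nat) (A : 'M[C]_(m, n)) (W : 'M[C]_n) (s : 'I_n -> C).
Hypotheses (WW : W *m W^t* = 1%:M) (s0 : forall i, 0 <= s i)
  (AA : A^t* *m A = W^t* *m diag_mx (\row_i s i ^+ 2) *m W).

Let WW' : W^t* *m W = 1%:M. Proof. exact: mulmx1C. Qed.

Lemma gram_diag : W *m A^t* *m (A *m W^t*) = diag_mx (\row_i s i ^+ 2).
Proof.
rewrite mulmxA -(mulmxA W) AA !mulmxA WW mul1mx.
by rewrite -mulmxA WW mulmx1.
Qed.

Lemma gram_diag_adj : W *m A^t* *m (W *m A^t*)^t* = diag_mx (\row_i s i ^+ 2).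
Proof. by rewrite adjmxM trmxCK gram_diag. Qed.

(** In the basis of right singular vectors, the trace is a sum of inner products of a row of W Q, of
    norm at most 1, with a row of W A^*, of norm s i. *)
Lemma mxtrace_contractmx_le (Q : 'M[C]_(n, m)) :
  contractmx Q -> `|\tr (Q *m A)| <= \sum_i s i.
Proof.
move=> cQ.
have -> : \tr (Q *m A) = \tr ((W *m Q) *m (W *m A^t*)^t*).
  by rewrite adjmxM trmxCK mxtrace_mulC [RHS]mxtrace_mulC mulmxA mulmxKtV//; apply/unitarymxP.
rewrite /mxtrace (le_trans (ler_norm_sum _ _ _))//; apply: ler_sum => i _.
rewrite -row_inner -[s i]mul1r norm_inner_le//.
  by rewrite row_mul (le_trans (cQ _))// expr1n /normsq row_inner WW mxE eqxx.
by rewrite /normsq row_inner gram_diag_adj !mxE eqxx mulr1n.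
Qed.

(** The maximizer is the adjoint of the polar factor of A. Since 0^-1 = 0, it vanishes on the null
    vectors of A and remains a contraction. *)
Lemma mxtrace_contractmx_eq :
  exists2 Q : 'M[C]_(n, m), contractmx Q & \tr (Q *m A) = \sum_i s i.
Proof.
pose D := diag_mx (\row_i (s i)^-1).
have cW : contractmx (W^t*) by apply: contractmx_coisometry; rewrite trmxCK.
exists (W^t* *m (D *m (W *m A^t*))).
  apply: contractmxM cW _ => x.
  rewrite {1}/normsq mulmxA adjmxM mulmxA -(mulmxA (x *m D)) gram_diag_adj.
  rewrite diag_form normsqE; apply: ler_sum => i _.
  rewrite mul_mx_diag !mxE normrM exprMn -mulrA ler_piMr ?exprn_ge0//.
  rewrite ger0_norm ?invr_ge0// -exprMn; have [->|si0] := eqVneq (s i) 0.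
    by rewrite mulr0 expr0n ler01.
  by rewrite mulVf// expr1n.
rewrite mxtrace_mulC mulmxA mxtrace_mulC -mulmxA.
rewrite gram_diag mulmx_diag mxtrace_diag; apply: eq_bigr => i _.
rewrite !mxE; have [->|si0] := eqVneq (s i) 0; first by rewrite expr2 !mulr0.
by rewrite expr2 mulKf.
Qed.

Lemma norm_bilinear_le (b : C) (x : 'rV[C]_m) (y : 'rV[C]_n) :
  0 <= b -> (forall i, s i <= b) -> normsq x <= 1 -> normsq y <= 1 ->
  `|(x *m A *m y^t*) 0 0| <= b.
Proof.
move=> b0 sb x1 y1; rewrite -[b]mul1r -mulmxA.
have -> : A *m y^t* = (y *m A^t*)^t* by rewrite adjmxM trmxCK.
rewrite norm_inner_le ?expr1n//.
have -> : normsq (y *m A^t*) =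
    ((y *m W^t*) *m diag_mx (\row_i s i ^+ 2) *m (y *m W^t*)^t*) 0 0.
  rewrite -gram_diag /normsq !adjmxM !trmxCK !mulmxA.
  by rewrite !(mulmxKtV _ (introT unitarymxP WW)).
apply: (@le_trans _ _ (b ^+ 2 * normsq (y *m W^t*))).
  rewrite diag_form normsqE mulr_sumr; apply: ler_sum => i _.
  by rewrite mulrC !mxE ler_wpM2r ?exprn_ge0// lerXn2r ?nnegrE.
have cW : contractmx (W^t*) by apply: contractmx_coisometry; rewrite trmxCK.
rewrite ler_piMr ?exprn_ge0//.
exact: le_trans (cW y) y1.
Qed.

(** The value s i is attained at the i-th right singular vector [y] and its normalized image; if s i
    = 0 there is nothing to normalize, and x = 0 serves. *)
Lemma bilinear_singular_value i : exists x y,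
  [/\ normsq x <= 1, normsq y <= 1 & (x *m A *m y^t*) 0 0 = s i].
Proof.
pose y := row i W; pose z := y *m A^t*.
have zz : normsq z = s i ^+ 2.
  by rewrite /z /y -row_mul /normsq row_inner gram_diag_adj !mxE eqxx mulr1n.
have y1 : normsq y = 1 by rewrite /normsq row_inner WW mxE eqxx.
have [si0|si0] := eqVneq (s i) 0.
  exists 0, y; rewrite y1 lexx !mul0mx si0 mxE; split=> //.
  by rewrite /normsq mul0mx mxE ler01.
exists ((s i)^-1 *: z), y; rewrite y1 lexx; split=> //.
  by rewrite normsqE; under eq_bigr do rewrite mxE normrM exprMn;
    rewrite -mulr_sumr -normsqE zz ger0_norm ?invr_ge0// -exprMn mulVf// expr1n.
have -> : (s i)^-1 *: z *m A *m y^t* = (s i)^-1 *: (z *m z^t*).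
  by rewrite -!scalemxAl -mulmxA {2}/z adjmxM trmxCK.
by rewrite mxE -/(normsq _) zz expr2 mulKf.
Qed.

End Dual.

(** * Complexified real matrices and the dual description of their norms *)

Section RealMatrices.
Local Open Scope classical_set_scope.
Local Open Scope sesquilinear_scope.
Local Open Scope complex_scope.
Context {R : realType}.

Definition cmx m n (A : 'M[R]_(m, n)) : 'M[R[i]]_(m, n) := map_mx (real_complex R) A.

Lemma cmxM m n p (A : 'M[R]_(m, n)) (B : 'M[R]_(n, p)) :
  cmx (A *m B) = cmx A *m cmx B.
Proof. exact: map_mxM. Qed.

Lemma cmx_adj m n (A : 'M[R]_(m, n)) : (cmx A)^t* = cmx A^T.
Proof. by apply/matrixP => i j; rewrite !mxE; exact: conjc_real. Qed.

Lemma cmx1 n : cmx (1%:M : 'M[R]_n) = 1%:M.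
Proof. exact: map_mx1. Qed.

Lemma cmxB m n (A B : 'M[R]_(m, n)) : cmx (A - B) = cmx A - cmx B.
Proof. exact: map_mxB. Qed.

Lemma cmx_inj m n : injective (@cmx m n).
Proof.
move=> A B /matrixP AB; apply/matrixP => i j.
by have := AB i j; rewrite !mxE => -[].
Qed.

Definition cdiag n (d : 'I_n -> R) : 'M[R[i]]_n := diag_mx (\row_i (d i)%:C).

Lemma cdiag_adj n (d : 'I_n -> R) : (cdiag d)^t* = cdiag d.
Proof.
apply/matrixP => i j; rewrite !mxE [in LHS]eq_sym; case: eqP => [->|_].
  by rewrite !mulr1n; exact: conjc_real.
by rewrite !mulr0n conjC0.
Qed.

Lemma cdiagM n (d e : 'I_n -> R) : cdiag d *m cdiag e = cdiag (fun i => d i * e i).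
Proof.
rewrite /cdiag mulmx_diag; congr diag_mx; apply/rowP => i.
by rewrite !mxE rmorphM.
Qed.

Definition specmx n (U : 'M[R[i]]_n) (d : 'I_n -> R) := U^t* *m cdiag d *m U.

Lemma specmxM n (U : 'M[R[i]]_n) (d e : 'I_n -> R) : U *m U^t* = 1%:M ->
  specmx U d *m specmx U e = specmx U (fun i => d i * e i).
Proof.
by move=> UU; rewrite /specmx -!mulmxA (mulmxA U) UU mul1mx (mulmxA (cdiag d)) cdiagM.
Qed.

Lemma mul_specmx n (U : 'M[R[i]]_n) (d : 'I_n -> R) : U *m U^t* = 1%:M ->
  U *m specmx U d = cdiag d *m U.
Proof. by move=> UU; rewrite /specmx !mulmxA UU mul1mx. Qed.

Lemma specmx_mul n (U : 'M[R[i]]_n) (d : 'I_n -> R) : U *m U^t* = 1%:M ->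
  specmx U d *m U^t* = U^t* *m cdiag d.
Proof. by move=> UU; rewrite /specmx -!mulmxA UU mulmx1. Qed.

Lemma specmx_adj n (U : 'M[R[i]]_n) (d : 'I_n -> R) : (specmx U d)^t* = specmx U d.
Proof. by rewrite /specmx !adjmxM trmxCK cdiag_adj mulmxA. Qed.

Lemma eq_specmx n (U : 'M[R[i]]_n) (d e : 'I_n -> R) :
  d =1 e -> specmx U d = specmx U e.
Proof. by move=> /funext ->. Qed.

Lemma symmetric_spectral n (A : 'M[R]_n) : A^T = A -> exists (U : 'M[R[i]]_n) (d : 'I_n -> R),
  U *m U^t* = 1%:M /\ cmx A = specmx U d.
Proof.
move=> AT.
have Ah : cmx A \is hermsymmx.
  apply: realsym_hermsym.
    apply/is_hermitianmxP; rewrite expr0 scale1r map_mx_id//.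
    by rewrite /cmx map_trmx AT.
  by apply/mxOverP => i j; rewrite mxE; apply/complex_realP; eexists.
have /orthomx_spectralP := hermitian_normalmx Ah.
have /mxOverP := hermitian_spectral_diag_real Ah.
have := spectral_unitarymx (cmx A).
move: (spectralmx _) (spectral_diag _) => U d Uu dreal AE.
exists U, (fun i => complex.Re (d 0 i)); split; first exact/unitarymxP.
have dE : d = \row_i (complex.Re (d 0 i))%:C.
  by apply/rowP => i; rewrite mxE RRe_real.
by rewrite AE (invmx_unitary Uu) /specmx /cdiag -dE.
Qed.

Lemma char_poly_spectral n (A : 'M[R]_n) (U : 'M[R[i]]_n) (d : 'I_n -> R) :
  U *m U^t* = 1%:M -> cmx A = specmx U d ->
  char_poly A = \prod_i ('X - (d i)%:P).
Proof.
move=> UU AE; apply: (@map_poly_inj _ _ (real_complex R)).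
rewrite map_char_poly -/(cmx A) rmorph_prod/=.
have UU' := mulmx1C UU.
have -> : char_poly (cmx A) = char_poly (cdiag d).
  rewrite /char_poly AE /char_poly_mx.
  set Q := map_mx polyC U; set Qi := map_mx polyC (U^t*).
  have QiQ : Qi *m Q = 1%:M by rewrite -map_mxM UU' map_mx1.
  have -> : 'X%:M - map_mx polyC (specmx U d) =
            Qi *m ('X%:M - map_mx polyC (cdiag d)) *m Q.
    rewrite !map_mxM/= mulmxBr mulmxBl; congr (_ - _).
    by rewrite scalar_mxC -mulmxA QiQ mulmx1.
  by rewrite !det_mulmx mulrAC -det_mulmx QiQ det1 mul1r.
rewrite char_poly_trig ?diag_mx_is_trig//; apply: eq_bigr => i _.
by rewrite rmorphB/= map_polyX map_polyC/= mxE eqxx mulr1n mxE.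
Qed.

(** Positivity is assumed on real vectors, while the rows of U are complex. But d i is a root of the
    real characteristic polynomial, hence has a real eigenvector. *)
Lemma psdmx_spectral n (A : 'M[R]_n) : psdmx A -> exists (U : 'M[R[i]]_n) (d : 'I_n -> R),
  [/\ U *m U^t* = 1%:M, cmx A = specmx U d & forall i, 0 <= d i].
Proof.
move=> [AT Apos]; have [U [d [UU AE]]] := symmetric_spectral AT.
exists U, d; split=> // i.
have : root (char_poly A) (d i).
  rewrite (char_poly_spectral UU AE) rootE horner_prod.
  by apply/prodf_eq0; exists i => //; rewrite hornerXsubC subrr.
rewrite -eigenvalue_root_char => /eigenvalueP[v vA v0].
have v_gt0 : 0 < (v *m v^T) 0 0 by rewrite lt0r sqnorm_eq0 v0 sqnorm_ge0.
rewrite -(pmulr_lge0 _ v_gt0).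
by have := Apos v^T; rewrite trmxK vA -scalemxAl mxE.
Qed.

(** The values s follow the order of the eigenbasis, while [singular_values] is sorted; agreement up
    to permutation is enough for a maximum or a sum. Only right singular vectors are recorded, since
    left ones come from A. *)
Lemma singular_value_decomposition m n (A : 'M[R]_(m, n)) :
  exists (W : 'M[R[i]]_n) (s : 'I_n -> R),
  [/\ W *m W^t* = 1%:M, forall i, 0 <= s i,
    (cmx A)^t* *m cmx A = W^t* *m diag_mx (\row_i (s i)%:C ^+ 2) *m W &
    perm_eq (singular_values A) [seq s i | i : 'I_n]].
Proof.
have gram_psd : psdmx (A^T *m A).
  split=> [|x]; first by rewrite trmx_mul trmxK.
  have := sqnorm_ge0 ((A *m x)^T); rewrite trmxK trmx_mul !mulmxA; exact.
have [W [d [WW AE d0]]] := psdmx_spectral gram_psd.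
pose s i := Num.sqrt (d i).
exists W, s; split.
- exact: WW.
- by move=> i; exact: sqrtr_ge0.
- rewrite cmx_adj -cmxM AE /specmx /cdiag; congr (_ *m diag_mx _ *m _).
  by apply/rowP => i; rewrite !mxE -rmorphXn/= sqr_sqrtr.
- set l := [seq s i | i : 'I_n].
  have ls : is_singular_values A (sort >=%R l).
    split.
    + by rewrite all_sort; apply/allP => _ /mapP[i _ ->]; exact: sqrtr_ge0.
    + by apply: sort_sorted => x y /=; rewrite le_total.
    + rewrite (char_poly_spectral WW AE) (perm_big _ (permEl (perm_sort _ _))).
      rewrite big_map big_enum/=; apply: eq_bigr => i _.
      by rewrite sqr_sqrtr.
  by rewrite (is_singular_values_uniq (singular_valuesP A) ls) perm_sort.
Qed.

Lemma contractmx_nuclear_norm m n (A : 'M[R]_(m, n)) (Q : 'M[R[i]]_(n, m)) :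
  contractmx Q -> `|\tr (Q *m cmx A)| <= (nuclear_norm A)%:C.
Proof.
move=> cQ; have [W [s [WW s0 AE p]]] := singular_value_decomposition A.
rewrite /nuclear_norm (perm_big _ p) big_map big_enum/= rmorph_sum/=.
by apply: (mxtrace_contractmx_le (s := fun i => (s i)%:C) WW _ AE cQ) => i; rewrite ler0c.
Qed.

(** Testing real parts is enough, as the extremal Q has a real trace. The tests must include complex
    Q, because the spectral resolutions and the resolvents are complex. *)
Lemma nuclear_norm_le m n (A : 'M[R]_(m, n)) (b : R) :
  (forall Q : 'M[R[i]]_(n, m), contractmx Q -> complex.Re (\tr (Q *m cmx A)) <= b) ->
  nuclear_norm A <= b.
Proof.
have [W [s [WW s0 AE p]]] := singular_value_decomposition A.
have [|Q cQ QE] := mxtrace_contractmx_eq WW _ AE; first by move=> i; rewrite ler0c.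
move=> /(_ _ cQ); rewrite QE -rmorph_sum/=.
by rewrite /nuclear_norm (perm_big _ p) big_map big_enum.
Qed.

Lemma spectral_norm_ge0 m n (A : 'M[R]_(m, n)) : 0 <= spectral_norm A.
Proof. exact: bigmax_ge_id. Qed.

Lemma norm_bilinear_spectral_norm m n (A : 'M[R]_(m, n)) (x : 'rV[R[i]]_m) (y : 'rV[R[i]]_n) :
  normsq x <= 1 -> normsq y <= 1 ->
  `|(x *m cmx A *m y^t*) 0 0| <= (spectral_norm A)%:C.
Proof.
move=> x1 y1; have [W [s [WW s0 AE p]]] := singular_value_decomposition A.
apply: (norm_bilinear_le WW _ AE) => // [i||i]; rewrite ?ler0c ?spectral_norm_ge0//.
rewrite lecR /spectral_norm (perm_big _ p) big_map big_enum/=.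
exact: le_bigmax.
Qed.

Lemma spectral_norm_le m n (A : 'M[R]_(m, n)) (b : R) : 0 <= b ->
  (forall (x : 'rV[R[i]]_m) (y : 'rV[R[i]]_n), normsq x <= 1 -> normsq y <= 1 ->
    complex.Re ((x *m cmx A *m y^t*) 0 0) <= b) ->
  spectral_norm A <= b.
Proof.
move=> b0 H; have [W [s [WW s0 AE p]]] := singular_value_decomposition A.
rewrite /spectral_norm (perm_big _ p) big_map big_enum/=.
apply/bigmax_leP; split=> // i _.
have [|x [y [x1 y1 E]]] := bilinear_singular_value WW _ AE i.
  by move=> j; rewrite ler0c.
by have := H x y x1 y1; rewrite E.
Qed.

End RealMatrices.

(** * Pseudoinverse and exponential in an eigenbasis *)

Section SpectralCalculus.
Context {R : realType}.
Local Open Scope classical_set_scope.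
Local Open Scope sesquilinear_scope.
Local Open Scope complex_scope.

(** The spectral candidate for the pseudoinverse is a complex matrix, so uniqueness is needed over
    the complex numbers, with adjoints in place of transposes. *)
Lemma penrose_unique m n (A : 'M[R[i]]_(m, n)) (X Y : 'M[R[i]]_(n, m)) :
  A *m X *m A = A -> X *m A *m X = X -> (A *m X)^t* = A *m X -> (X *m A)^t* = X *m A ->
  A *m Y *m A = A -> Y *m A *m Y = Y -> (A *m Y)^t* = A *m Y -> (Y *m A)^t* = Y *m A ->
  X = Y.
Proof.
move=> AXA XAX AXT XAT AYA YAY AYT YAT.
have AXY : A *m X = A *m Y.
  by rewrite -AXT -{1}AYA -(mulmxA (A *m Y)) adjmxM AXT AYT mulmxA AXA.
have XAY : X *m A = Y *m A.
  have -> : X *m A = (X *m A) *m (Y *m A) by rewrite -mulmxA (mulmxA A) AYA.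
  by rewrite -XAT -YAT -adjmxM -mulmxA (mulmxA A) AXA YAT.
by rewrite -XAX XAY -mulmxA AXY mulmxA.
Qed.

Variables (n : nat) (A : 'M[R]_n) (U : 'M[R[i]]_n) (d : 'I_n -> R).
Hypotheses (UU : U *m U^t* = 1%:M) (AE : cmx A = specmx U d).

(** Thanks to 0^-1 = 0, inverting the eigenvalues one by one satisfies the four Penrose equations
    even when A is singular. *)
Lemma cmx_mpinv : cmx (mpinv A) = specmx U (fun i => (d i)^-1).
Proof.
have [AXA XAX AXT XAT] := mpinvP A.
have dV i : d i * (d i)^-1 * d i = d i.
  by have [->|d0] := eqVneq (d i) 0; [rewrite mulr0|rewrite mulfVK].
have Vd i : (d i)^-1 * d i * (d i)^-1 = (d i)^-1.
  by have [->|d0] := eqVneq (d i) 0; [rewrite invr0 mulr0|rewrite mulVf// mul1r].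
apply: (@penrose_unique _ _ (cmx A)).
- by rewrite -!cmxM AXA.
- by rewrite -!cmxM XAX.
- by rewrite -cmxM cmx_adj AXT.
- by rewrite -cmxM cmx_adj XAT.
- by rewrite AE (specmxM _ _ UU) (specmxM _ _ UU); exact: eq_specmx.
- by rewrite AE (specmxM _ _ UU) (specmxM _ _ UU); exact: eq_specmx.
- by rewrite AE (specmxM _ _ UU); exact: specmx_adj.
- by rewrite AE (specmxM _ _ UU); exact: specmx_adj.
Qed.

Lemma cmxX j : cmx (A ^+ j) = specmx U (fun i => d i ^+ j).
Proof.
elim: j => [|j IHj].
  rewrite expr0; have -> : cmx (1 : 'M[R]_n) = 1%:M := cmx1 _.
  rewrite /specmx (_ : cdiag _ = 1%:M) ?mulmx1 ?(mulmx1C UU)//.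
  by apply/matrixP => i k; rewrite !mxE; case: eqP.
have -> : A ^+ j.+1 = A *m A ^+ j by rewrite exprS.
by rewrite cmxM IHj AE (specmxM _ _ UU); apply: eq_specmx => i; rewrite exprS.
Qed.

Lemma cvg_exp_sum (G : 'I_n -> 'M[R]_n) :
  series (fun j => (j`!%:R)^-1 *: \sum_l d l ^+ j *: G l) @ \oo -->
  \sum_l expR (d l) *: G l.
Proof.
have -> : series (fun j => (j`!%:R)^-1 *: \sum_l d l ^+ j *: G l) =
    (fun N => \sum_l series (exp_coeff (d l)) N *: G l).
  apply/funext => N; rewrite /series/=.
  under eq_bigr do rewrite scaler_sumr.
  rewrite exchange_big/=; apply: eq_bigr => l _.
  rewrite scaler_suml; apply: eq_bigr => j _.
  by rewrite scalerA /exp_coeff/= mulrC.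
apply: cvg_big => [|l _]; first exact: add_continuous.
by apply: cvgZr_tmp; exact: is_cvg_series_exp_coeff.
Qed.

Lemma cmx_mxexp : cmx (mxexp A) = specmx U (fun i => expR (d i)).
Proof.
(* [G l] and [H l] are the real and imaginary parts of the rank one spectral
   projections of [A]; the [G l] carry the powers of [A], the [H l] cancel out. *)
pose G l : 'M[R]_n := \matrix_(i, j) complex.Re ((U l i)^*%C * U l j).
pose H l : 'M[R]_n := \matrix_(i, j) complex.Im ((U l i)^*%C * U l j).
have specE f i j : specmx U f i j =
    (\sum_l f l *: G l) i j +i* (\sum_l f l *: H l) i j.
  rewrite /specmx -mulmxA mxE; apply/eqP; rewrite eq_complex; apply/andP; split.
    rewrite /= raddf_sum summxE/=; apply/eqP; apply: eq_bigr => l _.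
    rewrite mul_diag_mx !mxE; case: (U l j) => u v; case: (U l i) => u' v' /=. ring.
  rewrite /= raddf_sum summxE/=; apply/eqP; apply: eq_bigr => l _.
  rewrite mul_diag_mx !mxE; case: (U l j) => u v; case: (U l i) => u' v' /=. ring.
have AG j : A ^+ j = \sum_l d l ^+ j *: G l.
  apply/matrixP => i k; have /matrixP/(_ i k) := cmxX j.
  by rewrite specE mxE => -[].
have AH j : \sum_l d l ^+ j *: H l = 0.
  apply/matrixP => i k; have /matrixP/(_ i k) := cmxX j.
  by rewrite specE mxE => -[_ <-]; rewrite mxE.
have EG : mxexp A = \sum_l expR (d l) *: G l.
  rewrite /mxexp; under [X in series X]eq_fun do rewrite AG.
  by apply/cvg_lim => //; exact: cvg_exp_sum.
have EH : \sum_l expR (d l) *: H l = 0.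
  have := @cvg_exp_sum H; under [X in series X]eq_fun do rewrite AH scaler0.
  have -> : series (fun=> 0 : 'M[R]_n) = (fun=> 0).
    by apply/funext => N; rewrite /series/= big1.
  by move=> /cvg_lim <-//; rewrite lim_cst.
by apply/matrixP => i j; rewrite specE EH !mxE EG.
Qed.

End SpectralCalculus.

(** * The multiplier bound for matrices *)

Section MultiplierBound.
Context {R : realType}.
Local Open Scope sesquilinear_scope.
Local Open Scope complex_scope.
Variables c s : R.
Hypotheses (c0 : 0 < c) (s0 : 0 < s) (cs : c ^+ 2 + s ^+ 2 = 1).

(** Between U and W, the entries of X and of D are those of U W multiplied by f(a i) - f(b j) and by
    a i - b j. Hence tr (Q X) is the double sum of [Re_schur_exp_inv_le], and inserting factors x i
    and y j of modulus at most 1 there amounts to replacing Q by T Q S with contractions S and T.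
    Only W W^* = 1 is required, so W may have more columns than rows. *)
Lemma Re_mxtrace_le n m (U : 'M[R[i]]_n) (W : 'M[R[i]]_(n, m)) (X D Q : 'M[R[i]]_n)
    (a : 'I_n -> R) (b : 'I_m -> R) (nu t : R) : 0 < t ->
  U *m U^t* = 1%:M -> W *m W^t* = 1%:M ->
  (forall i, 0 <= a i) -> (forall j, 0 <= b j) ->
  (forall i j, (U *m X *m W) i j = (exp_inv t (a i) - exp_inv t (b j))%:C * (U *m W) i j) ->
  (forall i j, (U *m D *m W) i j = (a i - b j)%:C * (U *m W) i j) ->
  (forall S T, contractmx S -> contractmx T -> `|\tr (T *m Q *m S *m D)| <= nu%:C) ->
  complex.Re (\tr (Q *m X)) <= nu / s ^+ 2 / (pi * t * c).
Proof.
move=> t0 UU WW a0 b0 XE DE H; have UU' := mulmx1C UU.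
pose N := W^t* *m Q *m U^t*.
have cU : contractmx U by exact: contractmx_coisometry.
have cU' : contractmx (U^t*) by exact: contractmx_adj.
have cW : contractmx W by exact: contractmx_coisometry.
have cW' : contractmx (W^t*) by exact: contractmx_adj.
have -> : \tr (Q *m X) = \tr (N *m (U *m X *m W)).
  rewrite /N -!mulmxA [RHS]mxtrace_mulC !mulmxA -(mulmxA Q) UU' mulmx1.
  by rewrite -(mulmxA (Q *m X)) WW mulmx1.
have -> : \tr (N *m (U *m X *m W)) =
    \sum_i \sum_j N j i * (U *m W) i j * (exp_inv t (a i) - exp_inv t (b j))%:C.
  rewrite /mxtrace exchange_big/=; apply: eq_bigr => j _; rewrite mxE.
  by apply: eq_bigr => i _; rewrite XE mulrAC mulrA.
apply: (Re_schur_exp_inv_le c0 s0 cs) => // x y x1 y1.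
pose S := U^t* *m diag_mx (\row_i x i) *m U.
pose T := W *m diag_mx (\row_j y j) *m W^t*.
have -> : \sum_i \sum_j N j i * (U *m W) i j * (a i - b j)%:C * x i * y j =
    \tr (T *m Q *m S *m D).
  have -> : \tr (T *m Q *m S *m D) =
      \tr (diag_mx (\row_j y j) *m N *m (diag_mx (\row_i x i) *m (U *m D *m W))).
    by rewrite /T /S /N -!mulmxA [LHS]mxtrace_mulC !mulmxA.
  rewrite /mxtrace exchange_big/=; apply: eq_bigr => j _; rewrite mxE.
  apply: eq_bigr => i _.
  rewrite mul_diag_mx [X in _ = X * _]mxE mul_diag_mx [X in _ = _ * X]mxE.
  rewrite DE !mxE; ring.
have cS : contractmx S.
  apply: (contractmxM (contractmxM cU' _) cU).
  by apply: contractmx_diag => i; rewrite mxE.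
have cT : contractmx T.
  apply: (contractmxM (contractmxM cW _) cW').
  by apply: contractmx_diag => j; rewrite mxE.
exact: H.
Qed.

End MultiplierBound.

(** * The compression of L to the span of V and its null vectors *)

Section Compression.
Context {R : realType}.
Local Open Scope sesquilinear_scope.
Local Open Scope complex_scope.

(** In an eigenbasis of L, the diagonal entries of N^T L N are sums of the nonnegative terms d k |Y
    k j|^2, so each of these terms vanishes. *)
Lemma psdmx_congr_eq0 n m (L : 'M[R]_n) (N : 'M[R]_(n, m)) :
  psdmx L -> N^T *m L *m N = 0 -> L *m N = 0.
Proof.
move=> Lpsd NLN; have [U [d [UU LE d0]]] := psdmx_spectral Lpsd.
have [Y YE] : exists Y, Y = U *m cmx N by eexists.
have YY : Y^t* *m cdiag d *m Y = 0.
  have -> : Y^t* *m cdiag d *m Y = cmx (N^T *m L *m N).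
    by rewrite !cmxM LE /specmx -cmx_adj YE adjmxM !mulmxA.
  by rewrite NLN; apply/matrixP => i j; rewrite !mxE.
have dY : cdiag d *m Y = 0.
  apply/matrixP => i j; rewrite mul_diag_mx !mxE.
  have /matrixP/(_ j j) := YY; rewrite -mulmxA mxE [RHS]mxE => /eqP.
  have tE k : (Y^t*) j k * (cdiag d *m Y) k j = (d k)%:C * `|Y k j| ^+ 2.
    by rewrite mul_diag_mx !mxE normCK mulrCA [X in _ * X]mulrC.
  under eq_bigr do rewrite tE.
  rewrite psumr_eq0 => [/allP/(_ i (mem_index_enum i))|k _]; last first.
    by rewrite mulr_ge0 ?ler0c ?exprn_ge0.
  by rewrite /= mulf_eq0 expf_eq0/= normr_eq0 => /orP[]/eqP ->; rewrite ?mul0r ?mulr0.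
apply: cmx_inj; rewrite cmxM LE /specmx -!mulmxA -YE dY mulmx0.
by apply/matrixP => i j; rewrite !mxE.
Qed.

Definition projC n k (V : 'M[R]_(n, k)) : 'M[R]_n := 1%:M - V *m V^T.

(* As [V] is not square, [V W^*] alone does not resolve the identity: the columns
   of [projC V], on which the compressed operator vanishes, are adjoined. *)
Definition frame n k (V : 'M[R]_(n, k)) (W : 'M[R[i]]_k) : 'M[R[i]]_(n, k + n) :=
  row_mx (cmx V *m W^t*) (cmx (projC V)).

Variables (n k : nat) (L : 'M[R]_n) (V : 'M[R]_(n, k)).
Hypotheses (Lpsd : psdmx L) (VV : V^T *m V = 1%:M)
  (kerLV : forall x : 'cV[R]_n, L *m x = 0 -> exists y : 'cV[R]_k, x = V *m y).

Local Notation M := (V^T *m L *m V).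
Local Notation K := (mpinv L).
Local Notation E := (projC V).

Lemma compression_psd : psdmx M.
Proof.
have [LT Lpos] := Lpsd; split.
  by rewrite !trmx_mul trmxK LT mulmxA.
by move=> x; have := Lpos (V *m x); rewrite trmx_mul !mulmxA.
Qed.

Lemma projC_V : E *m V = 0.
Proof. by rewrite /projC mulmxBl mul1mx -mulmxA VV mulmx1 subrr. Qed.

Lemma projC_sym : E^T = E.
Proof. by rewrite /projC linearB/= trmx1 trmx_mul trmxK. Qed.

Lemma VT_projC : V^T *m E = 0.
Proof. by rewrite -projC_sym -trmx_mul projC_V trmx0. Qed.

Lemma projC_idem : E *m E = E.
Proof. by rewrite {1}/projC mulmxBl mul1mx -mulmxA VT_projC mulmx0 subr0. Qed.

(** This is where the kernel condition enters. The columns of 1 - K L are null vectors of L, hence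
    lie in the span of V and are killed by E; so E = E K L, and transposing shows that the range of
    E lies in the range of L. *)
Lemma projC_factor : E = L *m (K^T *m E).
Proof.
have [LT _] := Lpsd; have [LKL _ _ KLT] := mpinvP L.
suff : E *m (1%:M - K *m L) = 0.
  move=> /eqP; rewrite mulmxBr mulmx1 subr_eq0 => /eqP EE.
  have := congr1 trmx EE.
  by rewrite trmx_mul projC_sym trmx_mul LT mulmxA.
apply/matrixP => i j.
have [y xE] : exists y, col j (1%:M - K *m L) = V *m y.
  by apply: kerLV; rewrite colE mulmxA mulmxBr mulmx1 mulmxA LKL subrr mul0mx.
have : col j (E *m (1%:M - K *m L)) = 0.
  by rewrite colE -mulmxA -colE xE mulmxA projC_V mul0mx.
by move=> /matrixP/(_ i 0); rewrite mxE => ->; rewrite !mxE.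
Qed.

(** The columns of N = V (1 - M^+ M) satisfy N^T L N = 0, and positivity upgrades this to L N = 0: V
    maps null vectors of M to null vectors of L. *)
Lemma compression_factor : L *m V = L *m V *m (mpinv M *m M).
Proof.
have [MXM _ _ _] := mpinvP M.
apply/eqP; rewrite -subr_eq0 -{1}[L *m V]mulmx1 -mulmxBr -(mulmxA L); apply/eqP.
apply: psdmx_congr_eq0 => //.
have -> : (V *m (1%:M - mpinv M *m M))^T *m L *m (V *m (1%:M - mpinv M *m M)) =
    (1%:M - mpinv M *m M)^T *m (M *m (1%:M - mpinv M *m M)).
  by rewrite trmx_mul !mulmxA.
by rewrite [M *m _]mulmxBr mulmx1 (mulmxA M) MXM subrr mulmx0.
Qed.

Variables (U : 'M[R[i]]_n) (W : 'M[R[i]]_k) (d : 'I_n -> R) (e : 'I_k -> R).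
Hypotheses (UU : U *m U^t* = 1%:M) (LE : cmx L = specmx U d)
  (WW : W *m W^t* = 1%:M) (ME : cmx M = specmx W e).

Local Notation Z := (frame V W).

Lemma frame_coisometry : Z *m Z^t* = 1%:M.
Proof.
rewrite /frame tr_row_mx map_col_mx mul_row_col adjmxM trmxCK mulmxA -(mulmxA (cmx V)).
rewrite (mulmx1C WW) mulmx1 !cmx_adj -!cmxM projC_sym projC_idem.
by rewrite /projC cmxB addrC subrK cmx1.
Qed.

(** Row i of U is a left eigenvector of F for f i, and column j of V W^* is a right eigenvector of V
    H V^T for h j. The same computation serves the exponentials and the pseudoinverses. *)
Lemma intertwine_l (F : 'M[R]_n) (H : 'M[R]_k) (f : 'I_n -> R) (h : 'I_k -> R) i j :
  cmx F = specmx U f -> cmx H = specmx W h ->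
  (U *m cmx (F - V *m H *m V^T) *m Z) i (lshift n j) =
  (f i - h j)%:C * (U *m Z) i (lshift n j).
Proof.
move=> FE HE; rewrite /frame !mul_mx_row !row_mxEl.
have -> : U *m cmx (F - V *m H *m V^T) *m (cmx V *m W^t*) =
    cdiag f *m (U *m (cmx V *m W^t*)) - (U *m (cmx V *m W^t*)) *m cdiag h.
  rewrite cmxB mulmxBr mulmxBl; congr (_ - _).
    by rewrite FE mul_specmx// mulmxA.
  have HV : cmx (V *m H *m V^T) *m cmx V = cmx V *m cmx H.
    by rewrite -!cmxM -mulmxA VV mulmx1.
  rewrite -!(mulmxA U); congr (_ *m _); rewrite (mulmxA (cmx _)) HV HE.
  by rewrite -mulmxA specmx_mul// mulmxA.
by rewrite mxE mul_diag_mx [X in _ + X]mxE mul_mx_diag !mxE rmorphB/= mulrBl [X in _ - X]mulrC.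
Qed.

(** On the adjoined columns of E the compressed operator vanishes, so the second eigenvalue is 0. *)
Lemma intertwine_r (F : 'M[R]_n) (H : 'M[R]_k) (f : 'I_n -> R) i j :
  cmx F = specmx U f ->
  (U *m cmx (F - V *m H *m V^T) *m Z) i (rshift k j) =
  (f i)%:C * (U *m Z) i (rshift k j).
Proof.
move=> FE; rewrite /frame !mul_mx_row !row_mxEr -mulmxA -cmxM mulmxBl.
rewrite -(mulmxA (V *m H)) VT_projC mulmx0 subr0 cmxM FE mulmxA mul_specmx// -mulmxA.
by rewrite mul_diag_mx !mxE.
Qed.

(* The null vectors of [L] and of [V^T L V] correspond to each other; this removes the
   terms where f(0) = 0 differs from the value 1 of the exponential at a null vector. *)
Lemma overlap_null_l i j : d i = 0 -> e j != 0 -> (U *m Z) i (lshift n j) = 0.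
Proof.
move=> di ej; rewrite /frame mul_mx_row row_mxEl.
have ULE p (B : 'M[R]_(n, p)) : U *m cmx (L *m B) = cdiag d *m (U *m cmx B).
  by rewrite cmxM LE /specmx !mulmxA UU mul1mx.
(* Here V M = V V^T L V = L V - E L V, and [projC_factor] pulls L out of E as well; row i of U then
   turns L into the factor d i = 0. *)
have UVM : U *m (cmx V *m W^t*) *m cdiag e =
    cdiag d *m (U *m (cmx V *m W^t*) - U *m cmx (K^T *m E *m (L *m V)) *m W^t*).
  have -> : U *m (cmx V *m W^t*) *m cdiag e = U *m cmx (V *m M) *m W^t*.
    by rewrite cmxM ME /specmx !mulmxA -!(mulmxA _ W) WW mulmx1.
  have -> : V *m M = L *m V - L *m (K^T *m E *m (L *m V)).
    by rewrite (mulmxA L) -projC_factor /projC mulmxBl mul1mx subKr !mulmxA.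
  by rewrite cmxB !mulmxBr mulmxBl !ULE !mulmxA.
have /matrixP/(_ i j) := UVM; rewrite mul_mx_diag mul_diag_mx [LHS]mxE [RHS]mxE.
rewrite ![(\row__ _) 0 _]mxE di mul0r => /eqP; rewrite mulf_eq0 => /orP[/eqP//|].
by rewrite eq_complex/= (negPf ej).
Qed.

(** By [projC_factor] the columns of E lie in the range of L, which is orthogonal to its null
    vectors. *)
Lemma overlap_null_r i j : d i = 0 -> (U *m Z) i (rshift k j) = 0.
Proof.
move=> di; rewrite /frame mul_mx_row row_mxEr projC_factor cmxM LE mulmxA mul_specmx//.
by rewrite -mulmxA mul_diag_mx !mxE di mul0r.
Qed.

(** By [compression_factor], e j = 0 makes the j-th column of V W^* a null vector of L, orthogonal
    to the eigenvectors of nonzero eigenvalue. *)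
Lemma overlap_range i j : d i != 0 -> e j = 0 -> (U *m Z) i (lshift n j) = 0.
Proof.
move=> di ej; rewrite /frame mul_mx_row row_mxEl.
have ULV : cdiag d *m (U *m (cmx V *m W^t*)) =
    U *m cmx (L *m V *m mpinv M) *m W^t* *m cdiag e.
  have -> : U *m cmx (L *m V *m mpinv M) *m W^t* *m cdiag e = U *m cmx (L *m V) *m W^t*.
    rewrite [in RHS]compression_factor [in RHS]mulmxA [in RHS]cmxM ME /specmx !mulmxA.
    by rewrite -!(mulmxA _ W) WW mulmx1.
  by rewrite cmxM LE /specmx !mulmxA UU mul1mx.
have /matrixP/(_ i j) := ULV; rewrite mul_mx_diag mul_diag_mx [LHS]mxE [RHS]mxE.
rewrite ![(\row__ _) 0 _]mxE ej mulr0 => /eqP; rewrite mulf_eq0 => /orP[|/eqP//].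
by rewrite eq_complex/= (negPf di).
Qed.

End Compression.

(** * The bounds for the heat semigroup *)

Section Heat.
Context {R : realType}.
Local Open Scope sesquilinear_scope.
Local Open Scope complex_scope.

Lemma cmx_heat n (L : 'M[R]_n) (U : 'M[R[i]]_n) (d : 'I_n -> R) t :
  U *m U^t* = 1%:M -> cmx L = specmx U d ->
  cmx (mxexp (- (t *: L))) = specmx U (fun i => expR (- (t * d i))).
Proof.
move=> UU LE; apply: cmx_mxexp => //.
have -> : cmx (- (t *: L)) = (- t)%:C *: cmx L.
  by apply/matrixP => i j; rewrite !mxE -rmorphM/= mulNr.
rewrite /specmx; have -> : cdiag (fun i => - (t * d i)) = (- t)%:C *: cdiag d.
  by apply/matrixP => i j; rewrite !mxE mulrnAr -rmorphM/= mulNr.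
by rewrite -scalemxAr -scalemxAl LE.
Qed.

Lemma exp_invV (t x : R) : exp_inv t x^-1 = if x == 0 then 0 else expR (- (t * x)).
Proof. by rewrite /exp_inv invr_eq0 invrK. Qed.

Variables (n k : nat) (L : 'M[R]_n) (V : 'M[R]_(n, k)) (c s t : R).
Hypotheses (c0 : 0 < c) (s0 : 0 < s) (cs : c ^+ 2 + s ^+ 2 = 1).
Hypotheses (Lpsd : psdmx L) (VV : V^T *m V = 1%:M)
  (kerLV : forall x : 'cV[R]_n, L *m x = 0 -> exists y : 'cV[R]_k, x = V *m y)
  (t0 : 0 < t).

Local Notation M := (V^T *m L *m V).
Local Notation X := (mxexp (- (t *: L)) - V *m mxexp (- (t *: M)) *m V^T).
Local Notation D := (mpinv L - V *m mpinv M *m V^T).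

Lemma mxtrace_heat_le (nu : R) (Q : 'M[R[i]]_n) :
  (forall S T, contractmx S -> contractmx T ->
    `|\tr (T *m Q *m S *m cmx D)| <= nu%:C) ->
  complex.Re (\tr (Q *m cmx X)) <= nu / s ^+ 2 / (pi * t * c).
Proof.
move=> H.
have [U [d [UU LE d0]]] := psdmx_spectral Lpsd.
have [W [e [WW ME e0]]] := psdmx_spectral (compression_psd V Lpsd).
(* The eigenvalues of V M^+ V^T along the frame: those of M^+ on the columns from V, and 0 on the
   columns of E. *)
pose b (j : 'I_(k + n)) := if fintype.split j is inl j' then (e j')^-1 else 0.
have bl j : b (lshift n j) = (e j)^-1.
  by rewrite /b -/(unsplit (inl j)) unsplitK.
have br j : b (rshift k j) = 0.
  by rewrite /b -/(unsplit (inr j)) unsplitK.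
apply: (Re_mxtrace_le c0 s0 cs t0 UU (frame_coisometry VV WW) (X := cmx X) (D := cmx D)
  (a := fun i => (d i)^-1) (b := b)).
- by move=> i; rewrite invr_ge0.
- by move=> j; rewrite /b; case: fintype.split => // j'; rewrite invr_ge0.
- move=> i j; case: (split_ordP j) => j' ->.
    rewrite (intertwine_l VV UU WW _ _ (cmx_heat t UU LE) (cmx_heat t WW ME)).
    (* If both eigenvalues vanish, the exponentials give 1 - 1 and [exp_inv] gives 0 - 0; if exactly
       one vanishes, the two differences disagree but the overlap is 0. *)
    rewrite bl !exp_invV; case: eqP => [di|/eqP di]; case: eqP => [ej|/eqP ej] //.
    + by rewrite di ej !mulr0 !subrr.
    + by rewrite (overlap_null_l Lpsd VV kerLV UU LE WW ME) ?mulr0.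
    + by rewrite (overlap_range Lpsd UU LE WW ME) ?mulr0.
  rewrite (intertwine_r VV W UU _ _ _ (cmx_heat t UU LE)) br /exp_inv eqxx subr0.
  rewrite -/(exp_inv t (d i)^-1) exp_invV; case: eqP => [di|//].
  by rewrite (overlap_null_r Lpsd VV kerLV _ UU LE) ?mulr0.
- move=> i j; case: (split_ordP j) => j' ->.
    rewrite (intertwine_l VV UU WW _ _ (cmx_mpinv UU LE) (cmx_mpinv WW ME)).
    by rewrite bl.
  by rewrite (intertwine_r VV W UU _ _ _ (cmx_mpinv UU LE)) br subr0.
- exact: H.
Qed.

(** The dual matrices are the products y^* x with |x|, |y| <= 1; the contractions S and T turn one
    into another, with x S and y T^* as the new vectors. *)
Lemma spectral_norm_heat_le :
  spectral_norm X <= spectral_norm D / s ^+ 2 / (pi * t * c).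
Proof.
apply: spectral_norm_le => [|x y x1 y1].
  have tc0 : 0 < pi * t * c by rewrite !mulr_gt0 ?pi_gt0.
  by rewrite !divr_ge0 ?spectral_norm_ge0 ?sqr_ge0// ltW.
have <- : \tr (y^t* *m x *m cmx X) = (x *m cmx X *m y^t*) 0 0.
  by rewrite -mulmxA mxtrace_mulC trace_mx11.
apply: mxtrace_heat_le => S T cS cT.
have -> : \tr (T *m (y^t* *m x) *m S *m cmx D) =
    ((x *m S) *m cmx D *m (y *m T^t*)^t*) 0 0.
  by rewrite adjmxM trmxCK -trace_mx11 [RHS]mxtrace_mulC !mulmxA.
apply: norm_bilinear_spectral_norm; first exact: le_trans (cS x) x1.
exact: le_trans (contractmx_adj cT y) y1.
Qed.

(** The dual matrices are the contractions themselves, and T Q S is again one. *)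
Lemma nuclear_norm_heat_le :
  nuclear_norm X <= nuclear_norm D / s ^+ 2 / (pi * t * c).
Proof.
apply: nuclear_norm_le => Q cQ; apply: mxtrace_heat_le => S T cS cT.
by apply: contractmx_nuclear_norm; do 2?apply: contractmxM.
Qed.

End Heat.

(** * The choice of the angle and the final constant *)

Lemma sqrt_angle (R : realType) : exists c s : R,
  [/\ 0 < c, 0 < s, c ^+ 2 + s ^+ 2 = 1 &
   forall nu t, 0 < t ->
    nu / s ^+ 2 / (pi * t * c) = 3 * Num.sqrt 3 / (2 * pi) * (nu / t)].
Proof.
have s3 : 0 < Num.sqrt (3 : R) by rewrite sqrtr_gt0.
have s3E : Num.sqrt (3 : R) ^+ 2 = 3 by rewrite sqr_sqrtr.
have s23E : Num.sqrt (2 / 3 : R) ^+ 2 = 2 / 3 by rewrite sqr_sqrtr// divr_ge0.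
(* On 0 < c < 1, the product c s^2 = c (1 - c^2) has its maximum where 1 = 3 c^2, with value 2 / (3
   sqrt 3). *)
exists (Num.sqrt 3)^-1, (Num.sqrt (2 / 3)); split.
- by rewrite invr_gt0.
- by rewrite sqrtr_gt0 divr_gt0.
- by rewrite exprVn s3E s23E; field.
- move=> nu t t0; rewrite s23E; have := pi_gt0 R.
  move: (pi : R) (Num.sqrt (3 : R)) s3 => p r r0 p0; field.
  by rewrite !gt_eqF.
Qed.

Unset Implicit Arguments.

Theorem mainTheorem3 (R : realType) (n k : nat) (L : 'M[R]_n)
    (V : 'M[R]_(n, k)) (t : R) :
  psdmx L ->
  V^T *m V = 1%:M ->
  (forall x : 'cV[R]_n, L *m x = 0 -> exists y : 'cV[R]_k, x = V *m y) ->
  0 < t ->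
  let K := mpinv L in
  let P := mxexp (- (t *: L)) in
  let Pt := V *m mxexp (- (t *: (V^T *m L *m V))) *m V^T in
  let D := K - V *m mpinv (V^T *m L *m V) *m V^T in
  let nu2 := spectral_norm D in
  let nuS := nuclear_norm D in
  spectral_norm (P - Pt) <= 3 * Num.sqrt 3 / (2 * pi) * (nu2 / t) /\
  nuclear_norm (P - Pt) <= 3 * Num.sqrt 3 / (2 * pi) * (nuS / t).
Proof.
move=> Lpsd VV kerLV t0 K P Pt D nu2 nuS.
have [c [s [c0 s0 cs csE]]] := @sqrt_angle R.
rewrite -!(csE _ _ t0); split.
  exact: spectral_norm_heat_le.
exact: nuclear_norm_heat_le.
Qed.
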